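(* Let $f\colon\mathbb{R}^n\times\mathbb{R}^m\to\mathbb{R}^n$ satisfy $f(0,0)=0$ and be of class $C^1$ in a neighborhood of $(0,0)$. Put $A:=\nabla_x f(0,0)$ and $B:=\nabla_u f(0,0)$, and consider the control system $\dot x=f(x,u)$, $t\ge 0$. (Sufficiency) Let $\Lambda_+(A):=\{\lambda\in\mathbb{C} : \lambda \text{ is an eigenvalue of } A,\ \mathrm{Re}(\lambda)\ge 0\}$ and assume $\Lambda_+(A)\subset\mathbb{R}$. Assume in addition that $f$ is linearly open around $(0,0)$ with $\operatorname{cov} f(0,0)>\kappa$ for some positive constant $\kappa$ satisfying $$\kappa>\eta_c:=\sup_{\lambda\in\Lambda_+(A)}\lambda,\qquad \sup\emptyset:=-\infty.$$ Then the control system $\dot x=f(x,u)$ can be locally exponentially stabilized by means of continuous stationary feedback laws. (Necessity) Without any of the additional assumptions made in the sufficiency part (i.e. only assuming that $f$ is $C^1$ near $(0,0)$ with $f(0,0)=0$): if the control system $\dot x=f(x,u)$ can be locally exponentially stabilized by means of continuously differentiable stationary feedback laws, then $f$ is linearly open around $(0,0)$.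
   Context: Norms are Euclidean; $\mathbb{B}_r(z)$ is the closed ball of radius $r>0$ centered at $z$; $\mathbb{R}^n\times\mathbb{R}^m$ is identified with $\mathbb{R}^{n+m}$. Linear openness: a mapping $f\colon\mathbb{R}^l\to\mathbb{R}^n$ is linearly open around $\bar z$ with modulus $\kappa>0$ if there is a neighborhood $U$ of $\bar z$ such that $\mathbb{B}_{\kappa r}(f(z))\subset f(\mathbb{B}_r(z))$ for all $z\in U$ and $r>0$ with $\mathbb{B}_r(z)\subset U$. It is linearly open around $\bar z$ if this holds for some $\kappa>0$. The supremum of all such moduli $\kappa$ (over all neighborhoods $U$) is the exact covering bound $\operatorname{cov} f(\bar z)$. Local exponential stabilization: the system $\dot x=f(x,u)$ can be locally exponentially stabilized by means of continuous (respectively, continuously differentiable) stationary feedback laws if there exist a continuous (respectively, $C^1$) map $u\colon\mathbb{R}^n\to\mathbb{R}^m$ with $u(0)=0$ and constants $\alpha>0$, $M>0$, $\delta>0$ such that for every $x_0\in\mathbb{R}^n$ with $\|x_0\|<\delta$ there is a unique solution $x(t,x_0)$, $t\ge 0$, of $\dot x=f(x,u(x))$ with $x(0,x_0)=x_0$, and it satisfies $\|x(t,x_0)\|\le M e^{-\alpha t}\|x_0\|$ for all $t\ge 0$. *)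

(* Defs.v *)
From HB Require Import structures.
From mathcomp Require Import all_boot all_order all_algebra.
From mathcomp Require Import complex.
From mathcomp Require Import all_classical all_reals all_analysis.

Set Implicit Arguments.
Unset Strict Implicit.
Unset Printing Implicit Defensive.

Import Order.TTheory GRing.Theory Num.Theory.
Import numFieldNormedType.Exports.

Local Open Scope classical_set_scope.
Local Open Scope ring_scope.

(* Vectors of R^n are row vectors.  The library norm `|v| on 'rV[R]_n is the
   sup norm: it induces the usual topology and differential calculus, but moduli
   of linear openness depend on the norm, hence the Euclidean norm below. *)

Definition enorm (R : realType) (n : nat) (v : 'rV[R]_n) : R :=
  Num.sqrt (\sum_(i < n) v 0 i ^+ 2).

Definition eball (R : realType) (n : nat) (z : 'rV[R]_n) (r : R) :
    set 'rV[R]_n :=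
  [set y | enorm (y - z) <= r].

Definition lin_open_modulus (R : realType) (l n : nat)
    (f : 'rV[R]_l -> 'rV[R]_n) (zbar : 'rV[R]_l) (kappa : R) : Prop :=
  0 < kappa /\
  exists2 U : set 'rV[R]_l, nbhs zbar U &
    forall (z : 'rV[R]_l) (r : R), U z -> 0 < r -> eball z r `<=` U ->
      eball (f z) (kappa * r) `<=` f @` eball z r.

Definition lin_open (R : realType) (l n : nat)
    (f : 'rV[R]_l -> 'rV[R]_n) (zbar : 'rV[R]_l) : Prop :=
  exists kappa : R, lin_open_modulus f zbar kappa.

Definition cov (R : realType) (l n : nat)
    (f : 'rV[R]_l -> 'rV[R]_n) (zbar : 'rV[R]_l) : \bar R :=
  ereal_sup [set kappa%:E | kappa in lin_open_modulus f zbar].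

Definition C1_at (R : realType) (l n : nat)
    (f : 'rV[R]_l -> 'rV[R]_n) (z : 'rV[R]_l) : Prop :=
  differentiable f z /\ {for z, continuous (jacobian f)}.

Definition C1_near (R : realType) (l n : nat)
    (f : 'rV[R]_l -> 'rV[R]_n) (zbar : 'rV[R]_l) : Prop :=
  \forall z \near zbar, C1_at f z.

Definition C1 (R : realType) (l n : nat) (f : 'rV[R]_l -> 'rV[R]_n) : Prop :=
  forall z, C1_at f z.

(* R^n x R^m is identified with R^(n + m) through row_mx.  The library's
   jacobian acts on row vectors from the right ('d f z v = v *m jacobian f z):
   it is the transpose of the usual Jacobian matrix (nabla_x f | nabla_u f). *)

Definition nabla_x (R : realType) (n m : nat)
    (f : 'rV[R]_(n + m) -> 'rV[R]_n) (z : 'rV[R]_(n + m)) : 'M[R]_n :=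
  lsubmx (jacobian f z)^T.

(* ereal_sup of the empty set is -oo, as required for eta_c. *)

Definition Lambda_plus (R : realType) (n : nat) (A : 'M[R]_n) : set R[i] :=
  [set lambda | eigenvalue (map_mx (real_complex R) A) lambda /\
                0 <= complex.Re lambda].

Definition eta_c (R : realType) (n : nat) (A : 'M[R]_n) : \bar R :=
  ereal_sup [set (complex.Re lambda)%:E | lambda in Lambda_plus A].

(* Solution on [0, +oo[ of x' = g(x), x(0) = x0; the derivative at 0 is
   one-sided, and the values of x at negative times are irrelevant. *)

Definition is_solution (R : realType) (n : nat) (g : 'rV[R]_n -> 'rV[R]_n)
    (x0 : 'rV[R]_n) (x : R -> 'rV[R]_n) : Prop :=
  [/\ x 0 = x0,
      h^-1 *: (x h - x 0) @[h --> 0^'+] --> g (x 0)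
    & forall t : R, 0 < t -> is_derive t 1 x (g (x t))].

Definition loc_exp_stabilizing (R : realType) (n m : nat)
    (f : 'rV[R]_(n + m) -> 'rV[R]_n) (u : 'rV[R]_n -> 'rV[R]_m) : Prop :=
  u 0 = 0 /\
  exists alpha M delta : R, [/\ 0 < alpha, 0 < M, 0 < delta &
    forall x0 : 'rV[R]_n, enorm x0 < delta ->
      exists x : R -> 'rV[R]_n,
        [/\ is_solution (fun y => f (row_mx y (u y))) x0 x,
            forall x' : R -> 'rV[R]_n,
              is_solution (fun y => f (row_mx y (u y))) x0 x' ->
              forall t : R, 0 <= t -> x' t = x t
          & forall t : R, 0 <= t ->
              enorm (x t) <= M * expR (- (alpha * t)) * enorm x0]].

Definition loc_exp_stabilizable_C0 (R : realType) (n m : nat)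
    (f : 'rV[R]_(n + m) -> 'rV[R]_n) : Prop :=
  exists2 u : 'rV[R]_n -> 'rV[R]_m, continuous u & loc_exp_stabilizing f u.

Definition loc_exp_stabilizable_C1 (R : realType) (n m : nat)
    (f : 'rV[R]_(n + m) -> 'rV[R]_n) : Prop :=
  exists2 u : 'rV[R]_n -> 'rV[R]_m, C1 u & loc_exp_stabilizing f u.

(* Main.v *)
Require Import Defs.
From HB Require Import structures.
From mathcomp Require Import all_boot all_order all_algebra.
From mathcomp Require Import complex.
From mathcomp Require Import all_classical all_reals all_analysis.
From mathcomp Require Import ring lra.
Import Order.TTheory GRing.Theory Num.Theory.
Import numFieldNormedType.Exports.
Local Open Scope classical_set_scope.
Local Open Scope ring_scope.

(** The linearisation of f at the origin carries both halves of the proof.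
Write J for the Jacobian of f there; row vectors are multiplied on the right
by J, so that the transpose of J is the block matrix (A B).

Sufficiency.  An openness modulus kappa bounds the smallest singular value of
(A B) from below: kappa * enorm w <= enorm (w A, w B) for every row w
([lin_open_modulus_le]).  If w is a left eigenvector of A for a real
eigenvalue lambda with 0 <= lambda < kappa, then w B = 0 would give
kappa * enorm w <= lambda * enorm w; hence w B != 0.  Since all eigenvalues in
the closed right half-plane are real and below kappa, each of them can be moved
to -1 by a rank-one feedback that leaves the other ones where they are
([char_poly_rank_one], [stabilizing_feedback]).  This yields a linear feedback
for which the closed loop x' = g x has a Hurwitz linearisation G, hence a
quadratic Lyapunov function ([stable_lyapunov]), hence local exponential
stability ([lyapunov_stability]).  The last step includes existence of
solutions, obtained by Picard's iteration ([picard]), and uniqueness among all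
solutions, since the Lyapunov function confines them to a ball on which g is
Lipschitz.

Necessity.  If a C1 feedback u makes the closed loop exponentially stable, its
linearisation G at 0 is invertible: a vector w with G w = 0 would give a linear
functional that is conserved along trajectories up to higher order terms with
small integral, although trajectories tend to 0 ([exp_stable_injective]).  As G
is the product of (1 | u'(0)) and J, the matrix J has a left factor E with
E J = 1, and f is linearly open by Graves' theorem ([strict_diff_lin_open]). *)

Set Implicit Arguments.
Unset Strict Implicit.
Unset Printing Implicit Defensive.

(** * Scalar products and norms of row vectors *)

Definition dot {R : realType} {n : nat} (u v : 'rV[R]_n) : R :=
  \sum_i u 0 i * v 0 i.

Section Norms.
Context {R : realType}.

Lemma mx_norm_entry m n (M : 'M[R]_(m, n)) i j : `|M i j| <= `|M|.
Proof.
rewrite [leRHS]/Num.Def.normr/= mx_normrE.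
exact: (le_bigmax _ (fun ij => `|M ij.1 ij.2|) (i, j)).
Qed.

Lemma mx_norm_le m n (M : 'M[R]_(m, n)) (c : R) :
  0 <= c -> (forall i j, `|M i j| <= c) -> `|M| <= c.
Proof.
move=> c0 Mc; rewrite [leLHS]/Num.Def.normr/= mx_normrE.
by apply: bigmax_le => // -[i j] _; exact: Mc.
Qed.

Lemma mulmx_norm_le p m n (A : 'M[R]_(p, m)) (B : 'M[R]_(m, n)) :
  `|A *m B| <= m%:R * `|A| * `|B|.
Proof.
apply: mx_norm_le => [|i j]; first by rewrite !mulr_ge0.
rewrite mxE (le_trans (ler_norm_sum _ _ _))//.
apply: (@le_trans _ _ (\sum_(k < m) `|A| * `|B|)).
  by apply: ler_sum => k _; rewrite normrM ler_pM// mx_norm_entry.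
by rewrite sumr_const card_ord -[leLHS]mulr_natl mulrA.
Qed.

Lemma dotE n (u v : 'rV[R]_n) : dot u v = (u *m v^T) 0 0.
Proof. by rewrite mxE; apply: eq_bigr => i _; rewrite mxE. Qed.

Lemma dotDl n (u v w : 'rV[R]_n) : dot (u + v) w = dot u w + dot v w.
Proof. by rewrite !dotE mulmxDl mxE. Qed.

Lemma dotDr n (u v w : 'rV[R]_n) : dot u (v + w) = dot u v + dot u w.
Proof. by rewrite !dotE linearD mulmxDr mxE. Qed.

Lemma dotZl n a (u v : 'rV[R]_n) : dot (a *: u) v = a * dot u v.
Proof. by rewrite !dotE -scalemxAl mxE. Qed.

Lemma dotC n (u v : 'rV[R]_n) : dot u v = dot v u.
Proof. by apply: eq_bigr => i _; rewrite mulrC. Qed.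

Lemma dotZr n a (u v : 'rV[R]_n) : dot u (a *: v) = a * dot u v.
Proof. by rewrite dotC dotZl dotC. Qed.

Lemma dot_mulmx m n (u : 'rV[R]_m) (M : 'M[R]_(m, n)) (v : 'rV[R]_n) :
  dot (u *m M) v = dot u (v *m M^T).
Proof. by rewrite !dotE trmx_mul trmxK mulmxA. Qed.

Lemma dotvv_ge0 n (u : 'rV[R]_n) : 0 <= dot u u.
Proof. by apply: sumr_ge0 => i _; rewrite -expr2 sqr_ge0. Qed.

Lemma dot_norm_le n (u v : 'rV[R]_n) : `|dot u v| <= n%:R * `|u| * `|v|.
Proof.
rewrite dotE (le_trans (mx_norm_entry _ _ _))// (le_trans (mulmx_norm_le _ _))//.
rewrite ler_wpM2l ?mulr_ge0//; apply: mx_norm_le => // i j.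
by rewrite mxE mx_norm_entry.
Qed.

Lemma norm_sqr_le_dot n (u : 'rV[R]_n) : `|u| ^+ 2 <= dot u u.
Proof.
have le_coord i : u 0 i ^+ 2 <= dot u u.
  rewrite /dot (bigD1 i)//= expr2 lerDl sumr_ge0// => j _.
  by rewrite -expr2 sqr_ge0.
rewrite -[dot u u]sqr_sqrtr ?dotvv_ge0// lerXn2r ?nnegrE ?sqrtr_ge0//.
apply: mx_norm_le => [|i j]; first exact: sqrtr_ge0.
by rewrite ord1 -sqrtr_sqr ler_wsqrtr.
Qed.

Lemma dotvv_eq0 n (u : 'rV[R]_n) : (dot u u == 0) = (u == 0).
Proof.
apply/eqP/eqP => [u0|->]; last by rewrite /dot big1// => i _; rewrite mxE mul0r.
apply/eqP; rewrite -normr_eq0 -sqrf_eq0 eq_le sqr_ge0 andbT.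
by rewrite (le_trans (norm_sqr_le_dot _))// u0.
Qed.

Lemma enormE n (u : 'rV[R]_n) : enorm u = Num.sqrt (dot u u).
Proof. by congr Num.sqrt; apply: eq_bigr => i _; rewrite expr2. Qed.

Lemma enorm_ge0 n (u : 'rV[R]_n) : 0 <= enorm u.
Proof. exact: sqrtr_ge0. Qed.

Lemma enorm_sqr n (u : 'rV[R]_n) : enorm u ^+ 2 = dot u u.
Proof. by rewrite enormE sqr_sqrtr ?dotvv_ge0. Qed.

Lemma norm_le_enorm n (u : 'rV[R]_n) : `|u| <= enorm u.
Proof.
by rewrite -(@ler_pXn2r _ 2)// ?nnegrE ?enorm_ge0// enorm_sqr norm_sqr_le_dot.
Qed.

Lemma enorm_le_norm n (u : 'rV[R]_n) : enorm u <= n%:R * `|u|.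
Proof.
rewrite -(@ler_pXn2r _ 2)// ?nnegrE ?enorm_ge0 ?mulr_ge0// enorm_sqr.
rewrite (le_trans (ler_norm _))// (le_trans (dot_norm_le _ _))//.
rewrite -mulrA exprMn -expr2 ler_wpM2r// ?sqr_ge0//.
by rewrite -natrX ler_nat; case: n {u} => // n; rewrite expnS expn1 leq_pmulr.
Qed.

Lemma enormZ n a (u : 'rV[R]_n) : enorm (a *: u) = `|a| * enorm u.
Proof.
by rewrite !enormE dotZl dotZr mulrA -expr2 sqrtrM ?sqr_ge0// sqrtr_sqr.
Qed.

Lemma enorm_eq0 n (u : 'rV[R]_n) : (enorm u == 0) = (u == 0).
Proof. by rewrite -dotvv_eq0 -enorm_sqr sqrf_eq0. Qed.

Lemma enorm0 n : enorm (0 : 'rV[R]_n) = 0.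
Proof. by apply/eqP; rewrite enorm_eq0. Qed.

Lemma cauchy_schwarz n (u v : 'rV[R]_n) : `|dot u v| <= enorm u * enorm v.
Proof.
rewrite -(@ler_pXn2r _ 2)// ?nnegrE ?mulr_ge0 ?enorm_ge0// exprMn !enorm_sqr.
rewrite real_normK ?num_real//.
have [->|v0] := eqVneq v 0.
  by rewrite dotC /dot big1 ?expr0n/= ?mulr_ge0 ?dotvv_ge0// => i _; rewrite mxE mul0r.
have vv : 0 < dot v v by rewrite lt_def dotvv_eq0 v0 dotvv_ge0.
have := dotvv_ge0 (dot v v *: u - dot u v *: v).
rewrite -scaleNr dotDl !dotDr !(dotZl, dotZr) (dotC v u) => h.
rewrite -subr_ge0 -(pmulr_rge0 _ vv); by apply: etrans h; congr (_ <= _); ring.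
Qed.

Lemma enorm_row_mx0 m n (u : 'rV[R]_m) :
  enorm (row_mx u 0 : 'rV[R]_(m + n)) = enorm u.
Proof.
rewrite !enormE !dotE tr_row_mx mul_row_col mul0mx addr0//.
Qed.

(** A completeness statement with its rate of convergence, proved coordinatewise
by nested intervals: u k - 2 C / 2^k increases and u k + 2 C / 2^k decreases. *)
Lemma geometric_limit n (u : nat -> 'rV[R]_n) (C : R) :
  (forall k, `|u k.+1 - u k| <= C / 2 ^+ k) ->
  exists l, forall k, `|u k - l| <= 2 * C / 2 ^+ k.
Proof.
move=> uC; have C0 : 0 <= C by move: (uC 0%N); rewrite expr0 divr1; exact: le_trans.
suff coord (i : 'I_n) :
    exists l, forall k, `|u k 0 i - l| <= 2 * C / 2 ^+ k.
  have [l hl] := choice coord; exists (\row_i l i) => k.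
  apply: mx_norm_le => [|j i]; first by rewrite divr_ge0 ?mulr_ge0 ?exprn_ge0.
  by rewrite !mxE ord1.
pose b k := 2 * C / 2 ^+ k; pose v k := u k 0 i.
have bS k : b k - C / 2 ^+ k = b k.+1.
  by rewrite /b exprS; field; rewrite expf_neq0.
have vS k : `|v k.+1 - v k| <= b k - b k.+1.
  have -> : b k - b k.+1 = C / 2 ^+ k by rewrite -bS; ring.
  rewrite (le_trans _ (uC k))//.
  by rewrite (le_trans _ (mx_norm_entry _ 0 i))// !mxE.
have lo : {homo (fun k => v k - b k) : j k / (j <= k)%N >-> j <= k}.
  apply: homo_leq => //; first exact: le_trans.
  by move=> k; move: (vS k); rewrite ler_norml => /andP[]; lra.
have hi : {homo (fun k => v k + b k) : j k / (j <= k)%N >-> k <= j}.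
  apply: homo_leq => // [x y z yx|k]; first by move=> zy; exact: le_trans zy yx.
  by move: (vS k); rewrite ler_norml => /andP[]; lra.
have b0 k : 0 <= b k by rewrite divr_ge0 ?mulr_ge0 ?exprn_ge0.
have lohi j k : v j - b j <= v k + b k.
  have := lo _ _ (leq_maxl j k); have := hi _ _ (leq_maxr j k).
  by have := b0 (maxn j k); lra.
pose E := range (fun k => v k - b k).
have supE : has_sup E.
  by split; [exists (v 0 - b 0), 0|exists (v 0 + b 0) => _ [j _ <-]; exact: lohi].
exists (sup E) => k; rewrite ler_distl; apply/andP; split.
  by rewrite lerBlDr sup_le_ub//; [exact: supE.1|move=> _ [j _ <-]; exact: lohi].
by rewrite -lerBlDr; apply: (sup_upper_bound supE); exists k.
Qed.

End Norms.

(** * Strict differentiability *)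

(** The two-point form of differentiability, which for C1 maps follows from the
mean value theorem.  It composes like an ordinary derivative, contains a local
Lipschitz estimate, and is all that the Newton iteration and the analysis of
the flow require of f. *)
Definition strict_diff {R : realType} {l n : nat} (f : 'rV[R]_l -> 'rV[R]_n)
    (z : 'rV[R]_l) (J : 'M[R]_(l, n)) : Prop :=
  forall e : R, 0 < e -> exists2 r : R, 0 < r &
    forall x y, `|x - z| <= r -> `|y - z| <= r ->
      `|f x - f y - (x - y) *m J| <= e * `|x - y|.

Section StrictDiff.
Context {R : realType}.

Lemma is_derive_coord m n (x : R -> 'M[R]_(m, n)) (t : R) dx i j :
  is_derive t 1 x dx -> is_derive t 1 (fun s => x s i j) (dx i j).
Proof.
move=> [dx1 dx2]; split; first by move/derivable_mxP : dx1; exact.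
by rewrite -dx2 derive_mx// mxE.
Qed.

Lemma is_derive_line l n (f : 'rV[R]_l -> 'rV[R]_n) (y v : 'rV[R]_l) (s : R) :
  differentiable f (s *: v + y) ->
  is_derive s 1 (fun s => f (s *: v + y)) (v *m jacobian f (s *: v + y)).
Proof.
move=> df; rewrite -deriveEjacobian//.
have lineE : (fun h : R => f ((h *: 1 + s) *: v + y)) =
             (fun h : R => f (h *: v + (s *: v + y))).
  by apply/funext => h; rewrite scalerDl addrA [_%:A]mulr1.
split; first by apply/derivable1P; rewrite /= lineE;
  exact/(derivable1P f _ v).1/diff_derivable.
rewrite /derive /=.
set g1 := fun h : R => _; set g2 := fun h : R => _.
suff -> : g1 = g2 by [].
by apply/funext => h; rewrite /g1 /g2 /=; have /(congr1 (@^~ h)) /= -> := lineE.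
Qed.

Lemma is_derive1B (f g : R -> R) (t df dg : R) :
  is_derive t 1 f df -> is_derive t 1 g dg ->
  is_derive t 1 (fun s => f s - g s) (df - dg).
Proof. by move=> ? ?; exact: is_deriveB. Qed.

Lemma is_derive1Mr (c t : R) : is_derive t 1 (fun s : R => s * c) c.
Proof.
have : is_derive t 1 (c \*: (@id R)) (c *: 1) by exact: is_deriveZ.
rewrite [_ *: 1]mulr1; congr (is_derive _ _ _ _).
by apply/funext => s /=; rewrite mulrC.
Qed.

(** Along the segment from y to x, the map minus its linear part at z has a
derivative that is small, by continuity of the Jacobian at z. *)
Lemma C1_near_strict_diff l n (f : 'rV[R]_l -> 'rV[R]_n) (z : 'rV[R]_l) :
  C1_near f z -> strict_diff f z (jacobian f z).
Proof.
move=> fC1 e e0; pose e' := e / l.+1%:R.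
have e'0 : 0 < e' by rewrite divr_gt0.
have Jz : \forall z' \near z, `|jacobian f z - jacobian f z'| < e'.
  have [_ Jc] := nbhs_singleton fC1.
  by move/cvgrPdist_lt : Jc; exact.
have : \forall z' \near z, C1_at f z' /\ `|jacobian f z - jacobian f z'| < e'.
  by near=> z'; split; near: z'.
move=> /nbhs_ballP[r /= r0 rU].
have r20 : 0 < r / 2 by rewrite divr_gt0.
exists (r / 2) => // x y xz yz.
have seg (s : R) : 0 <= s <= 1 -> ball z r (s *: (x - y) + y).
  move=> /andP[s0 s1]; rewrite -ball_normE/= distrC.
  have -> : s *: (x - y) + y - z = s *: (x - z) + (1 - s) *: (y - z).
    by apply/rowP => i; rewrite !mxE; ring.
  rewrite (le_lt_trans (ler_normD _ _))// !normrZ ger0_norm// ger0_norm ?subr_ge0//.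
  rewrite (@le_lt_trans _ _ (s * (r / 2) + (1 - s) * (r / 2)))//.
    by rewrite lerD// ler_wpM2l// subr_ge0.
  by rewrite -mulrDl addrC subrK mul1r ltr_pdivrMr// ltr_pMr// ltr1n.
apply: mx_norm_le => [|k j]; first by rewrite mulr_ge0// ltW.
rewrite ord1 {k}.
(* phi is a coordinate of f on the segment, with its linear part removed *)
pose c := ((x - y) *m jacobian f z) 0 j.
pose phi (s : R) : R := f (s *: (x - y) + y) 0 j - s * c.
pose dphi (s : R) : R :=
  ((x - y) *m (jacobian f (s *: (x - y) + y) - jacobian f z)) 0 j.
have dphiP (s : R) : 0 <= s <= 1 -> is_derive s 1 phi (dphi s).
  move=> s01; have [[df _] _] := rU _ (seg _ s01).
  pose a := ((x - y) *m jacobian f (s *: (x - y) + y)) 0 j.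
  have -> : dphi s = a - c.
    by rewrite /dphi mulmxBr [in LHS]mxE; congr (_ + _); rewrite mxE.
  have h1 : is_derive s 1 (fun s : R => f (s *: (x - y) + y) 0 j) a.
    exact: (is_derive_coord 0 j (is_derive_line df)).
  exact: (is_derive1B h1 (is_derive1Mr c s)).
have [||s s01 E] := @MVT_segment _ phi dphi 0 1 ler01.
- by move=> s; rewrite in_itv/= => /andP[s0 s1]; apply: dphiP; rewrite !ltW.
- apply: derivable_within_continuous => s; rewrite in_itv/= => s01.
  by have [] := dphiP s s01.
have -> : (f x - f y - (x - y) *m jacobian f z) 0 j = phi 1 - phi 0.
  rewrite /phi /c !scale1r scale0r add0r subrK mul0r mul1r subr0 [LHS]mxE.
  by rewrite [X in X + _]mxE [X in _ + X = _]mxE [X in _ + X + _ = _]mxE; ring.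
rewrite E subr0 mulr1 (le_trans (mx_norm_entry _ _ _))//.
rewrite (le_trans (mulmx_norm_le _ _))//.
have {}s01 : 0 <= s <= 1.
  by move: s01; rewrite in_itv.
have [_ Js] := rU _ (seg _ s01); rewrite distrC in Js; have {}Js := ltW Js.
rewrite mulrAC ler_wpM2r//.
apply: (@le_trans _ _ (l%:R * e')); first by rewrite ler_wpM2l.
by rewrite /e' mulrCA ler_piMr ?(ltW e0)// ler_pdivrMr// mul1r ler_nat leqnSn.
Unshelve. all: by end_near. Qed.

End StrictDiff.

(** * Linear openness and the derivative *)

Section LinearOpenness.
Context {R : realType}.

Lemma le0_geometric (a K : R) : (forall k, a <= K / 2 ^+ k) -> a <= 0.
Proof.
move=> aK; rewrite leNgt; apply/negP => a0.
have K0 : 0 <= K by have := aK 0%N; rewrite expr0 divr1; lra.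
pose k := Num.truncn (K / a).
have kK : K / a < k.+1%:R by rewrite truncnS_gt.
have := aK k.+1; apply/negP; rewrite -ltNge ltr_pdivrMr ?exprn_gt0//.
rewrite mulrC -ltr_pdivrMr// (lt_trans kK)// -natrX ltr_nat ltn_expl//.
Qed.

Lemma strict_diff_lipschitz l n (f : 'rV[R]_l -> 'rV[R]_n) z J :
  strict_diff f z J -> exists2 r : R, 0 < r & exists2 L : R, 0 < L &
    forall x y, `|x - z| <= r -> `|y - z| <= r -> `|f x - f y| <= L * `|x - y|.
Proof.
move=> /(_ 1 ltr01)[r r0 fr]; exists r => //; exists (1 + l%:R * `|J|).
  by rewrite ltr_pwDl// mulr_ge0.
move=> x y xr yr; rewrite -(subrK ((x - y) *m J) (f x - f y)).
rewrite (le_trans (ler_normD _ _))// mulrDl lerD ?fr//.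
by rewrite (le_trans (mulmx_norm_le _ _))// mulrAC.
Qed.

Lemma strict_diff_comp l m n (h : 'rV[R]_l -> 'rV[R]_m)
    (f : 'rV[R]_m -> 'rV[R]_n) z H J :
  strict_diff h z H -> strict_diff f (h z) J ->
  strict_diff (f \o h) z (H *m J).
Proof.
move=> hH fJ e e0; have [r1 r10 [L L0 hL]] := strict_diff_lipschitz hH.
have [|r2 r20 fr] := fJ (e / 2 / L); first by rewrite !divr_gt0.
pose c := m%:R * `|J| + 1; have c0 : 0 < c by rewrite ltr_wpDl// mulr_ge0.
have [|r3 r30 hr] := hH (e / 2 / c); first by rewrite !divr_gt0.
pose r := Num.min (Num.min r1 r3) (r2 / L).
have [rr1 rr3 rr2] : [/\ r <= r1, r <= r3 & r <= r2 / L].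
  by rewrite /r !ge_min !lexx !orbT.
exists r => [|x y xr yr]; first by rewrite /r !lt_min r10 r30 divr_gt0.
have hball w : `|w - z| <= r -> `|h w - h z| <= r2.
  move=> wr; rewrite (le_trans (hL _ _ _ _)) ?subrr ?normr0 ?(ltW r10)//.
    exact: le_trans rr1.
  by rewrite mulrC -ler_pdivlMr// (le_trans wr).
have -> : (f \o h) x - (f \o h) y - (x - y) *m (H *m J) =
    (f (h x) - f (h y) - (h x - h y) *m J) + (h x - h y - (x - y) *m H) *m J.
  by rewrite [(_ - _ - _) *m J]mulmxBl mulmxA addrA subrK.
rewrite (le_trans (ler_normD _ _))// (splitr e) mulrDl lerD//.
  rewrite (le_trans (fr _ _ (hball _ xr) (hball _ yr)))//.
  rewrite -[leLHS]mulrA ler_wpM2l ?divr_ge0 ?(ltW e0)// ler_pdivrMl//.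
  by apply: hL; exact: le_trans rr1.
rewrite (le_trans (mulmx_norm_le _ _))//.
have hxy : `|h x - h y - (x - y) *m H| <= e / 2 / c * `|x - y|.
  by apply: hr; exact: le_trans rr3.
rewrite mulrAC (@le_trans _ _ (c * (e / 2 / c * `|x - y|)))//.
  by rewrite ler_pM ?mulr_ge0// /c lerDl.
by rewrite mulrA [c * _]mulrC divfK ?gt_eqF.
Qed.

Lemma strict_diff_graph n m (u : 'rV[R]_n -> 'rV[R]_m) z K :
  strict_diff u z K ->
  strict_diff (fun x => row_mx x (u x)) z (row_mx 1%:M K).
Proof.
move=> uK e e0; have [r r0 ur] := uK e e0; exists r => // x y xr yr.
rewrite mul_mx_row mulmx1 !opp_row_mx !add_row_mx subrr.
apply: mx_norm_le => [|i j]; first by rewrite mulr_ge0// ltW.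
rewrite mxE; case: splitP => k _; first by rewrite mxE normr0 mulr_ge0// ltW.
by rewrite (le_trans (mx_norm_entry _ _ _))// ur.
Qed.

Lemma strict_diff_linear l n (K : 'M[R]_(l, n)) z : strict_diff (mulmxr K) z K.
Proof.
move=> e e0; exists 1 => // x y _ _ /=.
by rewrite mulmxBl subrr normr0 mulr_ge0// ltW.
Qed.

(** Graves' theorem: Newton's iteration with the fixed left factor E, so that
E J = 1, halves the residual at each step, and the steps add up to at most
2 c `|y - f z|. *)
Lemma strict_diff_lin_open l n (f : 'rV[R]_l -> 'rV[R]_n) z0 J E :
  strict_diff f z0 J -> E *m J = 1%:M -> lin_open f z0.
Proof.
move=> fJ EJ; pose c : R := n%:R * `|E| + 1.
have c0 : 0 < c by rewrite ltr_wpDl// mulr_ge0.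
have [|r0 r00 fr] := fJ (2 * c)^-1; first by rewrite invr_gt0 mulr_gt0.
pose d : R := l.+1%:R; have d0 : 0 < d by [].
have ld : l%:R <= d by rewrite ler_nat.
(* the factor d converts between the sup norm and the Euclidean norm *)
exists (2 * c * d)^-1; split; first by rewrite invr_gt0 !mulr_gt0.
exists [set x | `|x - z0| <= r0].
  apply/nbhs_ballP; exists r0 => //= x; rewrite -ball_normE/= distrC.
  exact: ltW.
move=> z r Uz r_gt0 zrU y; rewrite /eball/= => yr.
pose rho := `|y - f z|; have rho0 : 0 <= rho := normr_ge0 _.
have rhor : 2 * c * rho <= r / d.
  have -> : r / d = 2 * c * ((2 * c * d)^-1 * r) by field; rewrite !gt_eqF.
  rewrite ler_wpM2l ?mulr_ge0 ?(ltW c0)//.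
  exact: le_trans (norm_le_enorm _) yr.
have cr0 : 0 <= c * rho by rewrite mulr_ge0// ltW.
have crr : 0 <= 2 * c * rho by rewrite -mulrA mulr_ge0.
have near_z x : `|x - z| <= 2 * c * rho -> eball z r x.
  move=> xz; rewrite /eball/= (le_trans (enorm_le_norm _))//.
  rewrite (@le_trans _ _ (d * (r / d)))//.
    by rewrite ler_pM// (le_trans xz).
  by rewrite mulrC divfK// gt_eqF.
pose step x := x + (y - f x) *m E.
pose s k := iter k step z.
have sE k : s k.+1 - s k = (y - f (s k)) *m E.
  by rewrite [s k.+1]/(step (s k)) addrC addKr.
have stepE k : `|y - f (s k)| <= rho / 2 ^+ k -> `|s k.+1 - s k| <= c * rho / 2 ^+ k.
  move=> yk; rewrite /s iterS -/(s k) /step addrAC subrr add0r.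
  rewrite (le_trans (mulmx_norm_le _ _))// mulrAC -[leRHS]mulrA ler_pM//.
  by rewrite /c lerDl.
have sP k : `|y - f (s k)| <= rho / 2 ^+ k /\
    `|s k - z| <= 2 * c * rho * (1 - (2 ^+ k)^-1).
  elim: k => [|k [yk sk]].
    by rewrite /s/= subrr normr0 expr0 divr1 invr1 subrr mulr0.
  have p0 : 0 < (2 ^+ k)^-1 :> R by rewrite invr_gt0 exprn_gt0.
  have p1 : (2 ^+ k.+1)^-1 = (2 ^+ k)^-1 / 2 :> R by rewrite exprS invfM mulrC.
  have sS : `|s k.+1 - z| <= 2 * c * rho * (1 - (2 ^+ k.+1)^-1).
    rewrite -(subrKA (s k)) (le_trans (ler_normD _ _))//.
    rewrite (le_trans (lerD (stepE _ yk) sk))// p1.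
    by rewrite le_eqVlt; apply/orP; left; apply/eqP; field.
  split => //.
  have U k' : `|s k' - z| <= 2 * c * rho * (1 - (2 ^+ k')^-1) -> `|s k' - z0| <= r0.
    move=> h; apply: zrU; apply: near_z; rewrite (le_trans h)//.
    by rewrite ler_piMr// gerBl invr_ge0 exprn_ge0.
  have := fr _ _ (U _ sS) (U _ sk).
  (* as E J = 1, the linear part of the step cancels the residual exactly *)
  have -> : f (s k.+1) - f (s k) - (s k.+1 - s k) *m J = f (s k.+1) - y.
    by rewrite sE -mulmxA EJ mulmx1 opprB addrA subrK.
  rewrite distrC => /le_trans; apply; rewrite mulrC.
  rewrite ler_pdivrMr ?mulr_gt0// (le_trans (stepE _ yk))// p1.
  by rewrite le_eqVlt; apply/orP; left; apply/eqP; field; rewrite gt_eqF.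
have [l0 sl] : exists l0, forall k, `|s k - l0| <= 2 * (c * rho) / 2 ^+ k.
  by apply: geometric_limit => k; apply: stepE; have [] := sP k.
have zl : `|l0 - z| <= 2 * c * rho.
  by have := sl 0%N; rewrite expr0 divr1 distrC mulrA.
exists l0; first exact: near_z.
apply/eqP; rewrite -subr_eq0 -normr_le0.
pose L := (2 * c)^-1 + l%:R * `|J|.
apply: (@le0_geometric _ (L * (2 * (c * rho)) + rho)) => k.
have [yk sk] := sP k.
rewrite -(subrKA (f (s k))) (le_trans (ler_normD _ _))// mulrDl lerD//; last first.
  by rewrite distrC.
have l0U : `|l0 - z0| <= r0 by apply: zrU; exact: near_z.
have skU : `|s k - z0| <= r0.
  apply: zrU; apply: near_z; rewrite (le_trans sk)//.
  by rewrite ler_piMr// gerBl invr_ge0 exprn_ge0.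
rewrite -(subrK ((l0 - s k) *m J) (f l0 - f (s k))) (le_trans (ler_normD _ _))//.
have L0 : 0 <= L by rewrite addr_ge0 ?mulr_ge0// invr_ge0 mulr_ge0// ltW.
rewrite -[leRHS]mulrA (le_trans _ (ler_wpM2l L0 (sl k)))//.
rewrite [`|s k - l0|]distrC /L mulrDl lerD ?fr//.
by rewrite (le_trans (mulmx_norm_le _ _))// mulrAC.
Qed.

(** Every modulus of openness is a lower bound for the smallest singular
value of the derivative: a target chosen in the direction w is reached from a
ball of radius r only if the linear part of f moves that far along w. *)
Lemma lin_open_modulus_le l n (f : 'rV[R]_l -> 'rV[R]_n) z J kappa :
  strict_diff f z J -> lin_open_modulus f z kappa ->
  forall w, kappa * enorm w <= enorm (w *m J^T).
Proof.
move=> fJ [k0 [U /nbhs_ballP[r1/= r10 r1U] Uopen]] w.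
have [->|w0] := eqVneq w 0; first by rewrite mul0mx !enorm0 mulr0.
have N0 : 0 < enorm w by rewrite lt_def enorm_eq0 w0 enorm_ge0.
apply/ler_addgt0Pr => e e0.
have [|r2 r20 fr] := fJ (e / (n.+1%:R * enorm w)); first by rewrite !divr_gt0 ?mulr_gt0.
pose r := Num.min (r1 / 2) r2.
have r0 : 0 < r by rewrite lt_min divr_gt0.
have rr1 : r < r1.
  by rewrite (@le_lt_trans _ _ (r1 / 2)) ?ge_min ?lexx// ltr_pdivrMr// ltr_pMr// ltr1n.
have rr2 : r <= r2 by rewrite ge_min lexx orbT.
have zrU : eball z r `<=` U.
  move=> x xr; apply: r1U; rewrite -ball_normE/= distrC.
  rewrite (le_lt_trans (norm_le_enorm _))//.
  exact: le_lt_trans rr1.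
have [|v vr fv] := Uopen z r (r1U _ (ballxx _ r10)) r0 zrU
    (f z + (kappa * r / enorm w) *: w).
  rewrite /eball/= addrAC subrr add0r enormZ ger0_norm; last first.
    by rewrite divr_ge0 ?enorm_ge0// mulr_ge0 ?(ltW k0) ?(ltW r0).
  by rewrite divfK// gt_eqF.
have vzr : `|v - z| <= r := le_trans (norm_le_enorm _) vr.
have zz2 : `|z - z| <= r2 by rewrite subrr normr0 ltW.
have errP := fr v z (le_trans vzr rr2) zz2.
set err := f v - f z - _ in errP.
have E : kappa * r * enorm w = dot ((v - z) *m J) w + dot err w.
  rewrite -dotDl /err addrC subrK fv addrAC subrr add0r dotZl -enorm_sqr.
  by field; rewrite gt_eqF.
rewrite -(ler_pM2l r0) mulrA [r * kappa]mulrC E mulrDr lerD//.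
  rewrite dot_mulmx (le_trans (ler_norm _))// (le_trans (cauchy_schwarz _ _))//.
  by rewrite ler_wpM2r ?enorm_ge0.
rewrite (le_trans (ler_norm _))// (le_trans (dot_norm_le _ _))//.
have -> : r * e = n.+1%:R * (e / (n.+1%:R * enorm w) * r) * enorm w.
  by field; rewrite gt_eqF//= pnatr_eq0.
rewrite ler_pM ?mulr_ge0 ?norm_le_enorm// ler_pM ?ler_nat//.
rewrite (le_trans errP)// ler_wpM2l// ltW// divr_gt0// mulr_gt0//.
Qed.

End LinearOpenness.

(** * Moving unstable eigenvalues by feedback *)

Section PoleShifting.

Lemma char_poly_trmx (F : comNzRingType) n (A : 'M[F]_n) :
  char_poly A^T = char_poly A.
Proof.
rewrite /char_poly -[RHS]det_tr; congr (\det _).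
by rewrite /char_poly_mx linearB/= tr_scalar_mx map_trmx.
Qed.

(** A rank-one perturbation along a left eigenvector moves that eigenvalue and
no other.  Since w is an eigenvector, w M = ('X - lambda) w for the
characteristic matrix M of A; the bordered matrix N, with blocks M, v, w and 1,
then has its determinant computed in two ways by block elimination, without
inverting M. *)
Lemma char_poly_rank_one (F : comNzRingType) n (A : 'M[F]_n) (v : 'cV[F]_n)
    (w : 'rV[F]_n) (lambda : F) :
  w *m A = lambda *: w ->
  char_poly (A + v *m w) * ('X - lambda%:P) =
  char_poly A * ('X - (lambda + (w *m v) 0 0)%:P).
Proof.
move=> wA; pose V := map_mx polyC v; pose W := map_mx polyC w.
pose M := char_poly_mx A.
have WM : W *m M = ('X - lambda%:P)%:M *m W.
  rewrite /M /char_poly_mx mulmxBr -map_mxM wA map_mxZ mul_mx_scalar.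
  by rewrite mul_scalar_mx -scalerBl.
have WV : W *m V = ((w *m v) 0 0)%:P%:M.
  by rewrite -map_mxM {1}[w *m v]mx11_scalar map_scalar_mx.
have Mvw : char_poly_mx (A + v *m w) = M - V *m W.
  by rewrite /M /char_poly_mx map_mxD map_mxM opprD addrA.
pose N := block_mx M V W 1%:M.
have detN : \det N = char_poly (A + v *m w).
  have : N *m block_mx 1%:M 0 (- W) 1%:M = block_mx (M - V *m W) V 0 1%:M.
    rewrite mulmx_block !mulmx1 !mul1mx !mulmx0 !add0r mulmxN.
    by rewrite subrr.
  move=> /(congr1 determinant); rewrite det_mulmx det_lblock det_ublock !det1.
  by rewrite !mulr1 -Mvw.
rewrite -detN.
have : block_mx 1%:M 0 (- W) ('X - lambda%:P)%:M *m N =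
    block_mx M V 0 ('X - (lambda + (w *m v) 0 0)%:P)%:M.
  rewrite mulmx_block !mul1mx !mul0mx !addr0 mulmx1 !mulNmx WM addNr WV.
  by rewrite [- _ + _]addrC -[X in block_mx _ _ _ X]raddfB/= -addrA -opprD -polyCD.
move=> /(congr1 determinant); rewrite det_mulmx det_lblock !det_ublock !det1.
by rewrite !det_scalar1 mul1r mulrC.
Qed.

End PoleShifting.

Section Stabilization.
Context {R : realType}.
Local Notation C := R[i].
Local Notation rc := (real_complex R).

Definition stable_poly (p : {poly R}) : Prop :=
  forall z : C, root (map_poly rc p) z -> complex.Re z < 0.

(** The eigenvalues in the closed right half-plane being real, each of them has
a real left eigenvector w; controllability of that mode means w *m B != 0, and
then a rank-one feedback moves the eigenvalue to -1.  The condition of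
controllability is invariant under feedback, so the process can be repeated
until no unstable eigenvalue is left. *)
Lemma stabilizing_feedback n m (A : 'M[R]_n) (B : 'M[R]_(n, m)) :
  (forall z : C, root (map_poly rc (char_poly A)) z -> 0 <= complex.Re z ->
     complex.Im z = 0) ->
  (forall (lambda : R) (w : 'rV[R]_n), 0 <= lambda -> w != 0 ->
     w *m A = lambda *: w -> w *m B != 0) ->
  exists F : 'M[R]_(m, n), stable_poly (char_poly (A + B *m F)).
Proof.
move=> Areal ctrl.
(* the roots of s are known to be stable, those of q may still have to be moved *)
suff gen k (q s : {poly R}) (F : 'M[R]_(m, n)) : (size q <= k)%N ->
    char_poly (A + B *m F) = q * s -> stable_poly s ->
    (forall z : C, root (map_poly rc q) z -> 0 <= complex.Re z ->
       complex.Im z = 0) ->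
    exists F : 'M[R]_(m, n), stable_poly (char_poly (A + B *m F)).
  apply: (gen _ (char_poly A) 1 0 (leqnn _)) => //.
    by rewrite mulmx0 addr0 mulr1.
  by move=> z; rewrite rmorph1 (negbTE (root1 z)).
elim: k q s F => [|k IH] q s F.
  rewrite size_poly_leq0 => /eqP ->; rewrite mul0r => /eqP.
  by rewrite (negbTE (monic_neq0 (char_poly_monic _))).
move=> qk AFqs s_stable q_real.
have [q_stable|] := pselect (stable_poly q).
  exists F => z; rewrite AFqs rmorphM rootM => /orP[]; first exact: q_stable.
  exact: s_stable.
move=> /existsNP[z /not_implyP[qz /negP]]; rewrite -leNgt => z0.
have zE : z = rc (complex.Re z).
  by move: (q_real z qz z0); case: z {qz z0} => a b /= ->.
pose l := complex.Re z.
have ql : root q l by move: qz; rewrite [X in root _ X]zE fmorph_root.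
have /factor_theorem[q1 qE] := ql.
have q1_neq0 : q1 != 0.
  apply/eqP => q10; have := monic_neq0 (char_poly_monic (A + B *m F)).
  by rewrite AFqs qE q10 !mul0r eqxx.
have /eigenvalueP[w wAF w0] : eigenvalue (A + B *m F) l.
  by rewrite eigenvalue_root_char AFqs rootM ql.
pose b := w *m B.
have b0 : b != 0.
  apply/eqP => b0; have := ctrl l w z0 w0; rewrite -/b b0 eqxx => H.
  by have := H; rewrite -wAF mulmxDr mulmxA -/b b0 mul0mx addr0 => /(_ erefl).
have bb : dot b b != 0 by rewrite dotvv_eq0.
(* with v = g *: (B *m b^T), the eigenvalue l becomes l + w v = -1 *)
pose g := - (l + 1) / dot b b.
pose F1 := F + g *: b^T *m w.
have F1E : A + B *m F1 = A + B *m F + (g *: (B *m b^T)) *m w.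
  by rewrite /F1 mulmxDr addrA -!scalemxAl -scalemxAr mulmxA.
apply: (IH q1 (('X + 1) * s) F1).
- move: qk; rewrite qE size_mul ?polyXsubC_eq0// size_XsubC addn2/= ltnS//.
- have := char_poly_rank_one (g *: (B *m b^T)) wAF.
  rewrite -F1E -scalemxAr mulmxA -/b mxE -dotE /g divfK//.
  have -> : l - (l + 1) = -1 by ring.
  rewrite polyCN opprK polyC1 AFqs qE => E.
  apply: (@mulIf _ ('X - l%:P)); first by rewrite polyXsubC_eq0.
  by rewrite E; ring.
- move=> z'; rewrite rmorphM rootM => /orP[|]; last exact: s_stable.
  rewrite rmorphD/= map_polyX rmorph1 -[1]opprK -polyC1 -polyCN root_XsubC.
  by move=> /eqP ->; rewrite /= ltrN10.
- move=> z' q1z'; apply: q_real; rewrite qE rmorphM rootM q1z'//.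
Qed.

End Stabilization.

(** * Quadratic Lyapunov functions of stable matrices *)

Section Lyapunov.
Context {R : realType}.
Local Notation C := R[i].
Local Notation rc := (real_complex R).

(** The real scalar product of the complex plane, Re (conj a * b). *)
Definition cdot (a b : C) : R :=
  complex.Re a * complex.Re b + complex.Im a * complex.Im b.

Lemma cdotDr (a b c : C) : cdot a (b + c) = cdot a b + cdot a c.
Proof. by case: a b c => [? ?] [? ?] [? ?]; rewrite /cdot/=; ring. Qed.

Lemma cdot_sumr I r (a : C) (F : I -> C) :
  cdot a (\sum_(i <- r) F i) = \sum_(i <- r) cdot a (F i).
Proof.
elim/big_rec2 : _ => [|i x y _ <-]; first by rewrite /cdot/= !mulr0 addr0.
exact: cdotDr.
Qed.

Lemma cdot_ge0 (a : C) : 0 <= cdot a a.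
Proof. by rewrite /cdot -!expr2 addr_ge0 ?sqr_ge0. Qed.

Lemma cdotM_diag (a h : C) : cdot a (a * h) = complex.Re h * cdot a a.
Proof. by case: a h => [? ?] [? ?]; rewrite /cdot/=; ring. Qed.

Lemma cdotM_le (a b h : C) (e : R) :
  `|complex.Re h| <= e -> `|complex.Im h| <= e ->
  cdot a (b * h) <= e * (cdot a a + cdot b b).
Proof.
case: a b h => [a1 a2] [b1 b2] [h1 h2]; rewrite /cdot/= => e1 e2.
have -> : a1 * (b1 * h1 - b2 * h2) + a2 * (b1 * h2 + b2 * h1) =
    h1 * (a1 * b1 + a2 * b2) + h2 * (a2 * b1 - a1 * b2) by ring.
have bound (h x y : R) : `|h| <= e -> `|x| <= y -> h * x <= e * y.
  by move=> he xy; rewrite (le_trans (ler_norm _))// normrM ler_pM.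
pose s := (a1 * a1 + a2 * a2 + (b1 * b1 + b2 * b2)) / 2.
have -> : e * (a1 * a1 + a2 * a2 + (b1 * b1 + b2 * b2)) = e * s + e * s.
  by rewrite /s; field.
by rewrite lerD// bound// /s ler_norml; apply/andP; split;
  have := sqr_ge0 (a1 + b1); have := sqr_ge0 (a2 + b2);
  have := sqr_ge0 (a1 - b1); have := sqr_ge0 (a2 - b2);
  have := sqr_ge0 (a1 + b2); have := sqr_ge0 (a2 + b1);
  have := sqr_ge0 (a1 - b2); have := sqr_ge0 (a2 - b1); lra.
Qed.

Lemma pos_lower_bound n (F : 'I_n -> R) :
  (forall i, 0 < F i) -> exists2 a, 0 < a & forall i, a <= F i.
Proof.
move=> F0; exists (\big[Num.min/1]_i F i); first by apply: lt_bigmin.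
by move=> i; apply: bigmin_le.
Qed.

(** Makes the Hermitian form of x W, for real x, a real quadratic form: this is
how a complex triangularisation yields a real Lyapunov function. *)
Definition realify n (W : 'M[C]_n) : 'M[R]_(n, n + n) :=
  row_mx (map_mx (@complex.Re R) W) (map_mx (@complex.Im R) W).

Lemma realifyE n (W : 'M[C]_n) (x y : 'rV[R]_n) :
  dot (x *m realify W) (y *m realify W) =
  \sum_j cdot ((map_mx rc x *m W) 0 j) ((map_mx rc y *m W) 0 j).
Proof.
have reE (z : 'rV[R]_n) j :
    (z *m map_mx (@complex.Re R) W) 0 j = complex.Re ((map_mx rc z *m W) 0 j).
  rewrite !mxE raddf_sum; apply: eq_bigr => k _; rewrite !mxE.
  by case: (W k j) => a b /=; ring.
have imE (z : 'rV[R]_n) j :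
    (z *m map_mx (@complex.Im R) W) 0 j = complex.Im ((map_mx rc z *m W) 0 j).
  rewrite !mxE raddf_sum; apply: eq_bigr => k _; rewrite !mxE.
  by case: (W k j) => a b /=; ring.
rewrite !dotE !mul_mx_row tr_row_mx mul_row_col mxE -!dotE -big_split/=.
by apply: eq_bigr => j _; rewrite /cdot -!reE -!imE.
Qed.

(** Lyapunov's theorem.  After a triangularisation P, rescaling the coordinates
by powers of a large t makes the off-diagonal entries small, so that the
diagonal, whose real parts are negative, dominates. *)
Lemma stable_lyapunov n (G : 'M[R]_n) :
  stable_poly (char_poly G) ->
  exists p (S : 'M[R]_(n, p)) (S' : 'M[R]_(p, n)) (a : R),
    [/\ 0 < a, S *m S' = 1%:M &
     forall x, dot (x *m S) (x *m G *m S) <= - a * dot (x *m S) (x *m S)].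
Proof.
move=> Gst; have [n0|n0] := posnP n.
  subst n; exists 0%N, 1%:M, 1%:M, 1; split => // [|x]; first by rewrite mulmx1.
  by rewrite /dot !big_ord0 mulr0.
pose GC := map_mx rc G.
have [P Punitary] := Schur GC n0; rewrite /similar_to => Ttrig.
have Pu : P \in unitmx := unitarymx_unit Punitary.
rewrite conjumx// in Ttrig; set T := _ *m invmx P in Ttrig.
have TP : T *m P = P *m GC by rewrite /T mulmxKV.
have Tdiag j : complex.Re (T j j) < 0.
  apply: Gst; rewrite map_char_poly -eigenvalue_root_char.
  have : eigenvalue T (T j j).
    rewrite eigenvalue_root_char char_poly_trig// /root horner_prod.
    by rewrite (bigD1 j)//= !hornerE subrr mul0r.
  move=> /eigenvalueP[v vT v0]; apply/eigenvalueP; exists (v *m P).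
    by rewrite -mulmxA -TP mulmxA vT scalemxAl.
  by apply: contraNneq v0 => vP; rewrite -(mulmxK Pu v) vP mul0mx.
have [a a0 aT] : exists2 a, 0 < a & forall j, a <= - complex.Re (T j j).
  by apply: pos_lower_bound => j; rewrite oppr_gt0.
pose tau := \sum_i \sum_j (`|complex.Re (T i j)| + `|complex.Im (T i j)|).
have tau_ge i j : `|complex.Re (T i j)| + `|complex.Im (T i j)| <= tau.
  rewrite /tau (bigD1 i)//= (bigD1 j)//= -addrA lerDl.
  apply: addr_ge0; apply: sumr_ge0 => k _; first exact: addr_ge0.
  by apply: sumr_ge0 => l _; exact: addr_ge0.
(* e is the size of off-diagonal entries that costs half of the decay rate a *)
pose e := a / (4 * n%:R).
have nR : 0 < n%:R :> R by rewrite ltr0n.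
have e0 : 0 < e by rewrite divr_gt0 ?mulr_gt0.
have tau0 : 0 <= tau.
  by apply: sumr_ge0 => i _; apply: sumr_ge0 => j _; exact: addr_ge0.
pose t := 1 + tau / e.
have t1 : 1 <= t by rewrite lerDl divr_ge0// ltW.
have t0 : 0 < t := lt_le_trans ltr01 t1.
have taut : tau / t <= e.
  rewrite ler_pdivrMr// /t mulrDr mulr1 mulrC divfK ?gt_eqF// lerDr ltW//.
pose D : 'M[C]_n := diag_mx (\row_j rc (t ^+ j)).
pose H : 'M[C]_n := \matrix_(i, j) (T i j * rc (t ^+ j / t ^+ i)).
have DH : D *m H = T *m D.
  rewrite mul_diag_mx mul_mx_diag; apply/matrixP => i j; rewrite !mxE.
  rewrite mulrCA -rmorphM/= [t ^+ i * _]mulrC divfK//.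
  by rewrite expf_neq0// gt_eqF.
have Du : D \in unitmx.
  rewrite unitmxE det_diag unitfE prodf_seq_neq0; apply/allP => j _ /=.
  by rewrite mxE fmorph_eq0 expf_neq0// gt_eqF.
pose W := invmx P *m D.
have Wu : W \in unitmx by rewrite unitmx_mul unitmx_inv Pu.
have GW : GC *m W = W *m H.
  have GP : GC *m invmx P = invmx P *m T.
    by rewrite -[LHS](mulKmx Pu) [P *m (_ *m _)]mulmxA -TP mulmxK.
  by rewrite /W -[RHS]mulmxA DH [LHS]mulmxA GP -mulmxA.
move: W Wu GW => W Wu GW.
have He i j : i != j -> `|complex.Re (H i j)| <= e /\ `|complex.Im (H i j)| <= e.
  move=> ij; rewrite mxE; have := tau_ge i j.
  have /is_trig_mxP/(_ i j) := Ttrig.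
  case: (T i j) => b c trig; rewrite /= !mulr0 subr0 add0r => bc.
  have [lt_ij|le_ji] := ltnP i j.
    by have [-> ->] := trig lt_ij; rewrite !mul0r normr0; split; exact: ltW.
  have lt_ji : (j < i)%N by rewrite ltn_neqAle le_ji andbT eq_sym.
  have q0 : 0 <= t ^+ j / t ^+ i by rewrite divr_ge0// exprn_ge0// ltW.
  have q1 : t ^+ j / t ^+ i <= t^-1.
    rewrite ler_pdivrMr ?exprn_gt0// -(subnKC lt_ji) addSn exprS mulKf ?gt_eqF//.
    by rewrite exprD ler_peMr ?exprn_ge0 ?exprn_ege1// ltW.
  have small r : `|r| <= tau -> `|r * (t ^+ j / t ^+ i)| <= e.
    move=> rt; rewrite normrM (ger0_norm q0) (le_trans _ taut)// ler_pM//.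
  split; apply: small; apply: le_trans bc; rewrite ?lerDl ?lerDr//.
exists (n + n)%N, (realify W), (pinvmx (realify W)), (a / 2).
split; first by rewrite divr_gt0.
  apply: mulmxVp; apply: inj_row_free => v vW.
  have : dot (v *m realify W) (v *m realify W) = 0.
    by apply/eqP; rewrite dotvv_eq0 vW.
  rewrite realifyE => /eqP; rewrite psumr_eq0; last by move=> i _; exact: cdot_ge0.
  move=> /allP h.
  have vW0 : map_mx rc v *m W = 0.
    apply/rowP => j; have := h j (mem_index_enum _); rewrite [RHS]mxE.
    case: ((_ *m _) 0 j) => b c; rewrite /cdot/= -!expr2.
    rewrite paddr_eq0 ?sqr_ge0// !sqrf_eq0 => /andP[/eqP -> /eqP ->].
    by [].
  have : map_mx rc v = 0 by rewrite -(mulmxK Wu (map_mx rc v)) vW0 mul0mx.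
  by move=> /eqP; rewrite map_mx_eq0 => /eqP.
move=> x; rewrite !realifyE map_mxM/= -mulmxA -/GC GW mulmxA.
set y := map_mx rc x *m W.
pose c k := cdot (y 0 k) (y 0 k); have c0 k : 0 <= c k := cdot_ge0 _.
rewrite -/(c _); pose V := \sum_j c j.
pose b j i := e * (c j + c i) - (if i == j then a * c j else 0).
apply: (@le_trans _ _ (\sum_j \sum_i b j i)).
  apply: ler_sum => j _; rewrite [(y *m H) 0 j]mxE cdot_sumr; apply: ler_sum => i _.
  rewrite /b; case: eqVneq => [->|ij].
    rewrite cdotM_diag [H j j]mxE divff ?expf_neq0 ?gt_eqF// rmorph1 mulr1 -/(c j).
    have := mulr_ge0 (ltW e0) (addr_ge0 (c0 j) (c0 j)).
    by have := ler_wpM2r (c0 j) (aT j); rewrite mulNr; lra.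
  have [h1 h2] := He i j ij.
  by rewrite subr0; apply: cdotM_le.
have sumb j : \sum_i b j i = e * (n%:R * c j + V) - a * c j.
  rewrite sumrB -mulr_sumr big_split/= sumr_const card_ord mulr_natl -/V.
  by rewrite -big_mkcond/= big_pred1_eq.
rewrite (eq_bigr _ (fun j _ => sumb j)) sumrB -!mulr_sumr big_split/= -mulr_sumr.
rewrite sumr_const card_ord -[V *+ n]mulr_natl -/V.
have -> : e = a / (4 * n%:R) by [].
rewrite le_eqVlt; apply/orP; left; apply/eqP; field.
by rewrite gt_eqF.
Qed.

End Lyapunov.

(** * Differential inequalities *)

Section RealCalculus.
Context {R : realType}.

Lemma is_derive1N (f : R -> R) (t df : R) :
  is_derive t 1 f df -> is_derive t 1 (fun s => - f s) (- df).
Proof. by move=> ?; exact: is_deriveN. Qed.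

Lemma is_derive1M (f g : R -> R) (t df dg : R) :
  is_derive t 1 f df -> is_derive t 1 g dg ->
  is_derive t 1 (fun s => f s * g s) (df * g t + f t * dg).
Proof.
move=> fP gP; rewrite addrC [df * _]mulrC.
exact: (@is_deriveM _ _ f g t 1 df dg).
Qed.

Lemma is_derive1_cst (c t : R) : is_derive t 1 (fun _ : R => c) 0.
Proof. exact: is_derive_cst. Qed.

Lemma is_derive1_sum n (f : 'I_n -> R -> R) (t : R) (df : 'I_n -> R) :
  (forall i, is_derive t 1 (f i) (df i)) ->
  is_derive t 1 (fun s => \sum_i f i s) (\sum_i df i).
Proof.
move=> fP; have -> : (fun s => \sum_i f i s) = \sum_i f i.
  by apply/funext => s; rewrite fct_sumE.
exact: is_derive_sum.
Qed.

Lemma is_derive_expRM (a t : R) :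
  is_derive t 1 (fun s : R => expR (a * s)) (a * expR (a * t)).
Proof.
rewrite mulrC; apply: (@is_derive1_comp _ expR (fun s => a * s)).
by under eq_fun do rewrite mulrC; exact: is_derive1Mr.
Qed.

Lemma is_derive_cvg_right (f : R -> R) (t df : R) :
  is_derive t 1 f df -> f s @[s --> t^'+] --> f t.
Proof.
move=> [df1 _]; apply: cvg_at_right_filter.
exact/differentiable_continuous/derivable1_diffP.
Qed.

Lemma nonincreasing_itv (f df : R -> R) (a b : R) : a <= b ->
  (forall t, a < t -> is_derive t 1 f (df t)) ->
  f s @[s --> a^'+] --> f a ->
  (forall t, a < t < b -> df t <= 0) ->
  f b <= f a.
Proof.
rewrite le_eqVlt => /orP[/eqP -> //|ab] fP fa df0.
have fc (t : R) : a < t -> {for t, continuous f}.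
  by move=> /fP[df1 _]; exact/differentiable_continuous/derivable1_diffP.
have [||t] := @MVT R f df a b ab.
- by move=> t; rewrite in_itv/= => /andP[at_ _]; exact: fP.
- apply/continuous_within_itvP => //; split => //.
    by move=> t; rewrite in_itv/= => /andP[at_ _]; exact: fc.
  by apply: cvg_at_left_filter; exact: fc.
rewrite in_itv/= => tab fE; rewrite -subr_le0 fE.
by rewrite mulr_le0_ge0 ?subr_ge0 ?(ltW ab)// df0.
Qed.

(** Gronwall's inequality: expR (a * t) * f t is nonincreasing.  The rate a may
be negative, which gives uniqueness for Lipschitz equations. *)
Lemma exp_decay (f df : R -> R) (a : R) :
  (forall t : R, 0 < t -> is_derive t 1 f (df t)) ->
  f s @[s --> 0^'+] --> f 0 ->
  (forall t : R, 0 < t -> df t <= - a * f t) ->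
  forall t : R, 0 <= t -> f t <= expR (- a * t) * f 0.
Proof.
move=> fP f0 dfa t t0.
have E (s : R) : expR (a * s) * expR (- a * s) = 1.
  by rewrite -expRD mulNr subrr expR0.
pose g (s : R) : R := expR (a * s) * f s.
have : g t <= g 0.
  apply: (@nonincreasing_itv g
    (fun s => a * expR (a * s) * f s + expR (a * s) * df s)) => //.
  - by move=> s s0; apply: is_derive1M (is_derive_expRM _ _) (fP s s0).
  - apply: cvgM => //; exact: is_derive_cvg_right (is_derive_expRM _ _).
  - move=> s /andP[s0 _]; have := dfa s s0; have := expR_gt0 (a * s) => e0.
    rewrite -(ler_pM2l e0) mulNr mulrN -lerBrDl sub0r => h; apply: le_trans h _.
    by rewrite lerN2 le_eqVlt; apply/orP; left; apply/eqP; ring.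
rewrite /g mulr0 expR0 mul1r -(ler_pM2l (expR_gt0 (- a * t))) mulrA.
by rewrite [expR (- a * t) * expR _]mulrC E mul1r.
Qed.

(** A continuity argument: decay is known only below the level c, but a function
that starts below c cannot leave that sublevel, since it decreases as long as
it stays inside.  The proof looks at the last time at which f <= f 0. *)
Lemma barrier (f df : R -> R) (a c : R) : 0 <= a -> (forall t : R, 0 <= f t) ->
  (forall t : R, 0 < t -> is_derive t 1 f (df t)) ->
  f s @[s --> 0^'+] --> f 0 -> f 0 < c ->
  (forall t : R, 0 < t -> f t <= c -> df t <= - a * f t) ->
  forall t : R, 0 <= t -> f t <= c.
Proof.
move=> a0 f_ge0 fP f0 f0c dfa T T0; rewrite leNgt; apply/negP => cT.
pose E := [set s | 0 <= s <= T /\ f s <= f 0].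
have E0 : E 0 by split; rewrite ?lexx.
have supE : has_sup E.
  by split; [exists 0|exists T => s [/andP[_ ]]].
pose s := sup E.
have s0 : 0 <= s by apply: (sup_upper_bound supE).
have sT : s <= T by apply: sup_le_ub; [exists 0|move=> r [/andP[_ ]]].
have fr (t : R) : 0 <= t -> f r @[r --> t^'+] --> f t.
  rewrite le_eqVlt => /orP[/eqP <- //|/fP]; exact: is_derive_cvg_right.
have fs : f s <= f 0.
  rewrite leNgt; apply/negP => fs.
  have s_gt0 : 0 < s.
    by rewrite lt_neqAle s0 andbT; apply: contraTneq fs => <-; rewrite ltxx.
  have [df1 _] := fP s s_gt0.
  have fc : {for s, continuous f} by exact/differentiable_continuous/derivable1_diffP.
  have /cvgr_gt/(_ _ fs)/nbhs_ballP[e /= e0 eP] := fc.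
  have [r [r0T fr0] ser] := sup_adherent e0 supE.
  have rs : r <= s by apply: (sup_upper_bound supE).
  have := eP r; rewrite /ball/= ger0_norm ?subr_ge0//.
  by rewrite ltrBlDl -ltrBlDr => /(_ ser); rewrite ltNge fr0.
have sT' : s < T.
  rewrite lt_neqAle sT andbT; apply: contraTneq cT => <-.
  by rewrite -leNgt (le_trans fs)// ltW.
have /cvgr_lt/(_ c (le_lt_trans fs f0c)) := fr s s0.
rewrite /at_right; move=> /nbhs_ballP[e /= e0 eP].
pose s1 := Num.min T (s + e / 2).
have ss1 : s < s1 by rewrite lt_min sT' ltrDl divr_gt0.
have s1T : s1 <= T by rewrite ge_min lexx.
have s1e : s1 <= s + e / 2 by rewrite ge_min lexx orbT.
have : f s1 <= f s.
  apply: (@nonincreasing_itv f df); first exact: ltW.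
  - by move=> t st; apply: fP; exact: le_lt_trans st.
  - exact: fr.
  - move=> t /andP[st ts1]; have t0 : 0 < t by exact: le_lt_trans st.
    have fc : f t < c.
      apply: (eP t) => //; rewrite /ball/= ltr0_norm ?subr_lt0// opprB ltrBlDl.
      rewrite (lt_le_trans ts1)// (le_trans s1e)// lerD2l ler_pdivrMr//.
      by rewrite ler_peMr ?ler1n// ltW.
    by rewrite (le_trans (dfa _ t0 (ltW fc)))// mulNr oppr_le0 mulr_ge0.
move=> fs1; have : E s1.
  by split; [rewrite s1T (le_trans s0)// ltW|exact: le_trans fs].
by move/(sup_upper_bound supE); rewrite leNgt ss1.
Qed.

End RealCalculus.

Section VectorCalculus.
Context {R : realType}.

Lemma is_derive_mx m n (x : R -> 'M[R]_(m, n)) (t : R) (dx : 'M[R]_(m, n)) :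
  (forall i j, is_derive t 1 (fun s => x s i j) (dx i j)) -> is_derive t 1 x dx.
Proof.
move=> xP; have dx1 : derivable x t 1 by apply/derivable_mxP => i j; have [] := xP i j.
split => //; rewrite derive_mx//; apply/matrixP => i j; rewrite mxE.
by have [] := xP i j.
Qed.

Lemma is_derive_mulmx m n (x : R -> 'rV[R]_m) (S : 'M[R]_(m, n)) (t : R)
    (dx : 'rV[R]_m) :
  is_derive t 1 x dx -> is_derive t 1 (fun s => x s *m S) (dx *m S).
Proof.
move=> xP; apply: is_derive_mx => i j; rewrite mxE.
have -> : (fun s => (x s *m S) i j) = (fun s => \sum_k x s i k * S k j).
  by apply/funext => s; rewrite mxE.
apply: is_derive1_sum => k.
have := is_derive1M (is_derive_coord i k xP) (is_derive1_cst (S k j) t).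
by rewrite mulr0 addr0.
Qed.

Lemma is_derive_dot n (x y : R -> 'rV[R]_n) (t : R) (dx dy : 'rV[R]_n) :
  is_derive t 1 x dx -> is_derive t 1 y dy ->
  is_derive t 1 (fun s => dot (x s) (y s)) (dot dx (y t) + dot (x t) dy).
Proof.
move=> xP yP; rewrite /dot -big_split/=; apply: is_derive1_sum => i.
exact: is_derive1M (is_derive_coord 0 i xP) (is_derive_coord 0 i yP).
Qed.

Lemma is_deriveB_mx n (x y : R -> 'rV[R]_n) (t : R) (dx dy : 'rV[R]_n) :
  is_derive t 1 x dx -> is_derive t 1 y dy ->
  is_derive t 1 (fun s => x s - y s) (dx - dy).
Proof. by move=> ? ?; exact: is_deriveB. Qed.

Lemma cvg_mulmx T m n (F : set_system T) {FF : Filter F} (x : T -> 'rV[R]_m)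
    (S : 'M[R]_(m, n)) (l : 'rV[R]_m) :
  x s @[s --> F] --> l -> (x s *m S) @[s --> F] --> l *m S.
Proof.
move=> /cvgrPdist_le xl; apply/cvgrPdist_le => e e0.
pose c := m%:R * `|S| + 1; have c0 : 0 < c by rewrite ltr_wpDl// mulr_ge0.
have := xl (e / c); rewrite divr_gt0// => /(_ isT); apply: filterS => s h.
rewrite -mulmxBl (le_trans (mulmx_norm_le _ _))// mulrAC.
rewrite (@le_trans _ _ (c * (e / c)))//; last by rewrite mulrC divfK ?gt_eqF.
by rewrite ler_pM ?mulr_ge0// /c lerDl.
Qed.

Lemma cvg_dot n (F : set_system R) {FF : Filter F} (x y : R -> 'rV[R]_n)
    (l k : 'rV[R]_n) :
  x s @[s --> F] --> l -> y s @[s --> F] --> k ->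
  dot (x s) (y s) @[s --> F] --> dot l k.
Proof.
move=> xl yk; rewrite /dot; apply: cvg_big => [|i _]; first exact: add_continuous.
apply: cvgM.
- exact: (cvg_comp _ (fun v : 'rV[R]_n => v 0 i) xl (@coord_continuous _ _ _ 0 i l)).
- exact: (cvg_comp _ (fun v : 'rV[R]_n => v 0 i) yk (@coord_continuous _ _ _ 0 i k)).
Qed.

(** Estimates a primitive of dx by differentiating the bound, coordinate by
coordinate; the weight c e^(a t) reproduces itself under this operation. *)
Lemma growth_bound n (x : R -> 'rV[R]_n) (dx : R -> 'rV[R]_n) (c a : R) :
  0 <= c -> x 0 = 0 ->
  (forall t : R, 0 <= t -> is_derive t 1 x (dx t)) ->
  (forall t : R, 0 <= t -> `|dx t| <= c * (a * expR (a * t))) ->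
  forall t : R, 0 <= t -> `|x t| <= c * expR (a * t).
Proof.
move=> c0 x0 xP dxb t t0; apply: mx_norm_le => [|i j].
  by rewrite mulr_ge0 ?expR_ge0.
rewrite {i}ord1.
have eP (s : R) : is_derive s 1 (fun s => c * expR (a * s)) (c * (a * expR (a * s))).
  have := is_derive1M (is_derive1_cst c s) (is_derive_expRM a s).
  by rewrite mul0r add0r.
have xjP (s : R) : 0 <= s -> is_derive s 1 (fun s => x s 0 j) (dx s 0 j).
  by move=> /xP; exact: is_derive_coord.
have dxj (s : R) : 0 <= s -> `|dx s 0 j| <= c * (a * expR (a * s)).
  by move=> s0; apply: le_trans (dxb s s0); exact: mx_norm_entry.
have bound (f df : R -> R) : f 0 = 0 ->
    (forall s : R, 0 <= s -> is_derive s 1 f (df s)) ->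
    (forall s : R, 0 <= s -> df s <= c * (a * expR (a * s))) ->
    f t <= c * expR (a * t).
  move=> f0 fP dfb.
  have gP (s : R) : 0 <= s -> is_derive s 1 (fun s => f s - c * expR (a * s))
      (df s - c * (a * expR (a * s))).
    by move=> /fP h; exact: is_derive1B h (eP s).
  have : f t - c * expR (a * t) <= f 0 - c * expR (a * 0).
    apply: (@nonincreasing_itv _ (fun s => f s - c * expR (a * s)) _ 0 t t0
      (fun s s0 => gP s (ltW s0))).
    - exact: is_derive_cvg_right (gP 0 (lexx _)).
    - by move=> s /andP[s0 _]; rewrite subr_le0 dfb// ltW.
  rewrite f0 sub0r mulr0 expR0 mulr1 => h.
  by rewrite -subr_le0 (le_trans h)// oppr_le0.
rewrite ler_norml; apply/andP; split; last first.
  apply: (bound (fun s => x s 0 j) (fun s => dx s 0 j)) => //.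
    by rewrite x0 mxE.
  by move=> s s0; rewrite (le_trans (ler_norm _))// dxj.
rewrite lerNl; apply: (bound (fun s => - x s 0 j) (fun s => - dx s 0 j)) => //.
- by rewrite x0 mxE oppr0.
- by move=> s s0; apply: is_derive1N; exact: xjP.
- by move=> s s0; rewrite (le_trans (ler_norm _))// normrN dxj.
Qed.

(** The integral starts at -1 so that time 0 is interior and the derivative at 0
is two-sided. *)
Lemma primitive_exists (h : R -> R) : continuous h ->
  exists H : R -> R, forall t : R, 0 <= t -> is_derive t 1 H (h t).
Proof.
move=> hc; pose mu := @lebesgue_measure R.
exists (fun x => (\int[mu]_(t in `[(-1)%R, x]) h t)%R) => t t0.
have t1 : t < t + 1 by rewrite ltrDl.
have [||d1 d2] := @continuous_FTC1_closed R h (-1) t (t + 1) t1 _ _ (hc t).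
- apply: continuous_compact_integrable; first exact: segment_compact.
  exact: continuous_subspaceT.
- by rewrite (lt_le_trans _ t0)// ltrN10.
by split => //; rewrite -d2 derive1E.
Qed.

Lemma primitive_rV n (h : R -> 'rV[R]_n) : continuous h ->
  exists2 H : R -> 'rV[R]_n, H 0 = 0 & forall t : R, 0 <= t -> is_derive t 1 H (h t).
Proof.
move=> hc.
have /choice[H HP] (j : 'I_n) : exists H : R -> R,
    forall t : R, 0 <= t -> is_derive t 1 H (h t 0 j).
  apply: primitive_exists => t; 
  exact: (cvg_comp _ (fun v : 'rV[R]_n => v 0 j) (hc t)
    (@coord_continuous _ _ _ 0 j (h t))).
exists (fun t => \row_j (H j t - H j 0)).
  by apply/rowP => j; rewrite !mxE subrr.
move=> t t0; apply: is_derive_mx => i j; rewrite ord1.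
have -> : (fun s => (\row_k (H k s - H k 0)) 0 j) = (fun s => H j s - H j 0).
  by apply/funext => s; rewrite mxE.
have := is_derive1B (HP j t t0) (is_derive1_cst (H j 0) t).
by rewrite subr0.
Qed.

End VectorCalculus.

(** * Solutions of differential equations near a stable equilibrium *)

Section Flow.
Context {R : realType}.

(** Picard's iteration.  Successive iterates on [0, +oo[ differ by at most
c 2^-k e^(2 L t): the weight e^(2 L t) makes integration of an L-Lipschitz
increment gain a factor 1/2 uniformly in t, whence a global solution. *)
Lemma picard n (g : 'rV[R]_n -> 'rV[R]_n) (L : R) (x0 : 'rV[R]_n) : 0 < L ->
  (forall x y, `|g x - g y| <= L * `|x - y|) ->
  exists2 x : R -> 'rV[R]_n, x 0 = x0 &
    forall t : R, 0 <= t -> is_derive t 1 x (g (x t)).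
Proof.
move=> L0 gL.
have /choice[P PP] (h : R -> 'rV[R]_n) : exists H : R -> 'rV[R]_n,
    continuous h -> H 0 = 0 /\ forall t : R, 0 <= t -> is_derive t 1 H (h t).
  have [hc|nhc] := pselect (continuous h); last by exists h.
  by have [H H0 HP] := primitive_rV hc; exists H.
(* negative times are sent to 0, so that only t >= 0 matters for continuity *)
pose fr (X : R -> 'rV[R]_n) (s : R) := X (Num.max s 0).
pose step X (t : R) := x0 + P (g \o fr X) t.
have gc : continuous g.
  move=> v; apply/(@cvgrPdist_le _ _ _ (nbhs v)) => e e0.
  apply/nbhs_ballP; exists (e / L) => /=; first by rewrite divr_gt0.
  move=> w; rewrite -ball_normE/= => vw.
  by rewrite (le_trans (gL _ _))// mulrC -ler_pdivlMr// ltW.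
have gfr X : continuous (fr X) -> continuous (g \o fr X).
  by move=> Xc t; apply: (continuous_comp (Xc t)); exact: gc.
have stepP X : continuous (fr X) -> step X 0 = x0 /\
    forall t : R, 0 <= t -> is_derive t 1 (step X) (g (X t)).
  move=> /gfr/PP[H0 HP]; split=> [|t t0]; first by rewrite /step H0 addr0.
  have := HP t t0; rewrite /= /fr max_l// => H.
  by rewrite -[g (X t)]add0r; apply: is_deriveD.
have maxc : continuous (fun s : R => Num.max s 0).
  by move=> s; apply: (@continuous_max _ _ id (cst 0)); [exact: cvg_id|exact: cvg_cst].
have frc X : (forall t : R, 0 <= t -> {for t, continuous X}) -> continuous (fr X).
  move=> Xc t; apply: (continuous_comp (maxc t)); apply: Xc.
  by rewrite le_max lexx orbT.
have stepc X : continuous (fr X) -> continuous (fr (step X)).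
  move=> /stepP[_ XP]; apply: frc => t /XP[dX _].
  exact/differentiable_continuous/derivable1_diffP.
pose u k := iter k step (fun=> x0).
have uc k : continuous (fr (u k)).
  elim: k => [|k IH]; last exact: stepc.
  by move=> t; exact: cvg_cst.
have u0 k : u k 0 = x0 by case: k => // k; have [] := stepP _ (uc k).
have uP k (t : R) : 0 <= t -> is_derive t 1 (u k.+1) (g (u k t)).
  by have [_] := stepP _ (uc k); apply.
pose c := `|g x0| / (2 * L).
have L20 : 0 < 2 * L by rewrite mulr_gt0.
have c0 : 0 <= c by rewrite divr_ge0// ltW.
have p0 k : 0 < 2 ^+ k :> R by rewrite exprn_gt0.
have inc k : forall t : R, 0 <= t ->
    `|u k.+1 t - u k t| <= c / 2 ^+ k * expR (2 * L * t).
  elim: k => [|k IH].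
    apply: (@growth_bound _ _ (fun t => u 1%N t - u 0%N t)
      (fun t => g (u 0%N t) - 0)) => [|||s s0].
    - by rewrite expr0 divr1.
    - by rewrite !u0 subrr.
    - by move=> s s0; apply: is_deriveB_mx (uP 0%N s s0) _; exact: is_derive_cst.
    - rewrite subr0 expr0 divr1 mulrA /c divfK ?gt_eqF// ler_peMr//.
      by rewrite -[leLHS]expR0 ler_expR mulr_ge0 ?(ltW L20).
  apply: (@growth_bound _ _ (fun t => u k.+2 t - u k.+1 t)
    (fun t => g (u k.+1 t) - g (u k t))) => [|||s s0].
  - by rewrite divr_ge0// ltW.
  - by rewrite !u0 subrr.
  - by move=> s s0; exact: is_deriveB_mx (uP k.+1 s s0) (uP k s s0).
  - rewrite (le_trans (gL _ _))// (le_trans (ler_wpM2l (ltW L0) (IH s s0)))//.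
    rewrite exprS le_eqVlt; apply/orP; left; apply/eqP; field.
    by rewrite gt_eqF.
have /choice[x xP] (t : R) : exists l, 0 <= t ->
    forall k, `|u k t - l| <= 2 * (c * expR (2 * L * t)) / 2 ^+ k.
  have [t0|_] := boolP (0 <= t); last by exists 0.
  have [|l lP] := @geometric_limit _ _ (u^~ t) (c * expR (2 * L * t)).
    by move=> k; rewrite mulrAC; exact: inc.
  by exists l.
have xc : continuous (fr x).
  move=> s; apply/cvgrPdist_le => e e0.
  pose m (r : R) := Num.max r 0.
  have m0 r : 0 <= m r by rewrite le_max lexx orbT.
  pose K := 2 * (c * expR (2 * L * (m s + 1))).
  have [k Kk] : exists k, K / 2 ^+ k <= e / 3.
    apply/not_existsP => h; have := @le0_geometric _ (e / 3) K.
    rewrite leNgt divr_gt0//= => /(_ _)/negP; apply => // k.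
    by have /negP := h k; rewrite -ltNge => /ltW.
  have cl r : m r <= m s + 1 -> `|u k (m r) - x (m r)| <= e / 3.
    move=> rs; rewrite (le_trans (xP _ (m0 r) k))// (le_trans _ Kk)//.
    rewrite ler_wpM2r ?invr_ge0 ?(ltW (p0 k))// /K !ler_wpM2l// ler_expR.
    by rewrite ler_wpM2l// ltW.
  have near_m : \forall r \near s, `|m s - m r| <= 1.
    by have /cvgrPdist_le := maxc s; apply.
  have near_u : \forall r \near s, `|fr (u k) s - fr (u k) r| <= e / 3.
    by have /cvgrPdist_le := uc k s; apply; rewrite divr_gt0.
  near=> r.
  have mr : m r <= m s + 1.
    rewrite -lerBlDl (le_trans (ler_norm _))// distrC.
    by near: r.
  have ur : `|u k (m s) - u k (m r)| <= e / 3.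
    by near: r.
  rewrite /fr -/(m s) -/(m r).
  have -> : x (m s) - x (m r) = (x (m s) - u k (m s)) +
      (u k (m s) - u k (m r)) + (u k (m r) - x (m r)).
    by rewrite !subrKA.
  rewrite (le_trans (ler_normD _ _))//.
  have -> : e = e / 3 + e / 3 + e / 3 by field.
  rewrite lerD ?cl// (le_trans (ler_normD _ _))// lerD//.
  by rewrite distrC cl// lerDl.
have [Y0 YP] := stepP _ xc.
exists (step x) => // t t0; suff <- : x t = step x t by exact: YP.
apply/eqP; rewrite eq_sym -subr_eq0 -normr_le0.
apply: (@le0_geometric _ _ (2 * (c * expR (2 * L * t)))) => k.
have Yu : `|step x t - u k.+1 t| <= c / 2 ^+ k * expR (2 * L * t).
  move: t t0; apply: (@growth_bound _ _ (fun t => step x t - u k.+1 t)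
    (fun t => g (x t) - g (u k t))).
  - by rewrite divr_ge0// ltW.
  - by rewrite Y0 u0 subrr.
  - by move=> s s0; exact: is_deriveB_mx (YP s s0) (uP k s s0).
  - move=> s s0; rewrite (le_trans (gL _ _))// distrC.
    rewrite (le_trans (ler_wpM2l (ltW L0) (xP s s0 k)))//.
    rewrite le_eqVlt; apply/orP; left; apply/eqP; field.
    by rewrite gt_eqF.
rewrite -(subrKA (u k.+1 t)) (le_trans (ler_normD _ _))//.
rewrite (le_trans (lerD Yu (xP t t0 k.+1)))// exprS.
rewrite le_eqVlt; apply/orP; left; apply/eqP; field.
by rewrite gt_eqF.
Unshelve. all: by end_near. Qed.

Lemma is_derive_is_solution n (g : 'rV[R]_n -> 'rV[R]_n) x0 x : x 0 = x0 ->
  (forall t : R, 0 <= t -> is_derive t 1 x (g (x t))) -> is_solution g x0 x.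
Proof.
move=> x00 xP; split => //; last by move=> t /ltW; exact: xP.
have [dx dxE] := xP 0 (lexx 0).
apply: cvg_dnbhs_at_right; rewrite -dxE.
have : h^-1 *: ((x \o shift 0) (h *: 1) - x 0) @[h --> 0^'] --> 'D_1 x 0 by exact: dx.
by under eq_fun do rewrite /= addr0 [_ *: 1]mulr1.
Qed.

(** The one-sided derivative at 0 gives the right-continuity that comparison
arguments starting at time 0 need. *)
Lemma is_solution_cvg0 n (g : 'rV[R]_n -> 'rV[R]_n) x0 x :
  is_solution g x0 x -> x s @[s --> 0^'+] --> x 0.
Proof.
move=> [_ xr _].
have : (x 0 + s *: (s^-1 *: (x s - x 0))) @[s --> 0^'+] --> x 0 + (0 : R) *: g (x 0).
  apply: cvgD; first exact: cvg_cst.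
  apply: cvgZ => //; exact/cvg_at_right_filter/cvg_id.
rewrite scale0r addr0; apply: cvg_trans; apply: near_eq_cvg.
near=> s; have s0 : 0 < s by near: s; exact: nbhs_right_gt.
by rewrite scalerA divff ?gt_eqF// scale1r addrC subrK.
Unshelve. all: by end_near. Qed.

(** The dissipation inequality is assumed on the sublevel set V <= c only, which
solutions starting inside never leave, by [barrier]. *)
Lemma lyapunov_decay n p (g : 'rV[R]_n -> 'rV[R]_n) (S : 'M[R]_(n, p)) (a c : R) x0 x :
  0 <= a ->
  (forall y, dot (y *m S) (y *m S) <= c ->
     dot (y *m S) (g y *m S) <= - a * dot (y *m S) (y *m S)) ->
  dot (x0 *m S) (x0 *m S) < c -> is_solution g x0 x ->
  forall t : R, 0 <= t -> dot (x t *m S) (x t *m S) <= c /\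
    dot (x t *m S) (x t *m S) <= expR (- (2 * a) * t) * dot (x0 *m S) (x0 *m S).
Proof.
move=> a0 gV Vc xsol; have [x00 _ xP] := xsol.
pose V t := dot (x t *m S) (x t *m S).
pose dV t := dot (g (x t) *m S) (x t *m S) + dot (x t *m S) (g (x t) *m S).
have VP (t : R) : 0 < t -> is_derive t 1 V (dV t).
  by move=> /xP/(is_derive_mulmx S) h; exact: is_derive_dot.
have V0 : V s @[s --> 0^'+] --> V 0.
  by apply: cvg_dot; apply: cvg_mulmx; exact: is_solution_cvg0 xsol.
have dVle t : V t <= c -> dV t <= - (2 * a) * V t.
  by move=> /gV; rewrite /dV [dot (g _ *m S) _]dotC /V; lra.
have Vle t : 0 <= t -> V t <= c.
  apply: (@barrier _ V dV (2 * a)) => //; first by rewrite mulr_ge0.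
  - by move=> s; exact: dotvv_ge0.
  - by rewrite /V x00.
  - by move=> s _; exact: dVle.
move=> t t0; split; first exact: Vle.
rewrite -x00; apply: (@exp_decay _ V dV) => // s s0; apply/dVle/Vle; exact: ltW.
Qed.

(** The squared distance of two solutions satisfies Gronwall's inequality. *)
Lemma solution_unique n (g : 'rV[R]_n -> 'rV[R]_n) (L r : R) x0 x y :
  0 <= L ->
  (forall u v, `|u| <= r -> `|v| <= r -> `|g u - g v| <= L * `|u - v|) ->
  is_solution g x0 x -> is_solution g x0 y ->
  (forall t : R, 0 <= t -> `|x t| <= r) -> (forall t : R, 0 <= t -> `|y t| <= r) ->
  forall t : R, 0 <= t -> x t = y t.
Proof.
move=> L0 gL xsol ysol xr yr t t0.
have [x00 _ xP] := xsol; have [y00 _ yP] := ysol.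
pose V t := dot (x t - y t) (x t - y t).
pose dV t := dot (g (x t) - g (y t)) (x t - y t) + dot (x t - y t) (g (x t) - g (y t)).
pose a := 2 * n%:R * L.
have : V t <= expR (- (- a) * t) * V 0.
  apply: (@exp_decay _ V dV) => //.
  - move=> s s0; have := is_deriveB_mx (xP s s0) (yP s s0) => h.
    exact: is_derive_dot.
  - by apply: cvg_dot; apply: cvgB;
      [exact: is_solution_cvg0 xsol|exact: is_solution_cvg0 ysol|
       exact: is_solution_cvg0 xsol|exact: is_solution_cvg0 ysol].
  - move=> s /ltW s0; rewrite opprK /dV dotC.
    set d := x s - y s; set e := g _ - g _.
    have de : dot d e <= n%:R * L * V s.
      rewrite (le_trans (ler_norm _))// (le_trans (dot_norm_le _ _))//.
      apply: (@le_trans _ _ (n%:R * L * `|d| ^+ 2)); last first.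
        by rewrite ler_wpM2l ?mulr_ge0// norm_sqr_le_dot.
      have := ler_wpM2l (normr_ge0 d) (gL _ _ (xr s s0) (yr s s0)).
      rewrite -/d -/e => h; rewrite -!mulrA ler_wpM2l//.
      by rewrite (le_trans h)// mulrCA expr2.
    by rewrite /a; lra.
rewrite {2}/V x00 y00 subrr; have -> : dot (0 : 'rV[R]_n) 0 = 0.
  by apply/eqP; rewrite dotvv_eq0.
rewrite mulr0 => V0; apply/eqP; rewrite -subr_eq0 -dotvv_eq0 eq_le V0.
exact: dotvv_ge0.
Qed.

(** The projection on a ball of the sup norm: being 1-Lipschitz, it turns a field
that is Lipschitz on the ball into a globally Lipschitz one. *)
Definition clamp n (r : R) (x : 'rV[R]_n) : 'rV[R]_n :=
  \row_i Num.max (- r) (Num.min r (x 0 i)).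

Lemma clamp_norm n r (x : 'rV[R]_n) : 0 <= r -> `|clamp r x| <= r.
Proof.
move=> r0; apply: mx_norm_le => // i j; rewrite mxE ler_norml.
by rewrite le_max lexx/= ge_max ge_min lexx andbT ge0_cp.
Qed.

Lemma clamp_lipschitz n r (x y : 'rV[R]_n) : `|clamp r x - clamp r y| <= `|x - y|.
Proof.
have minL (a b : R) : `|Num.min r a - Num.min r b| <= `|a - b|.
  by rewrite /Num.min; case: (ltP r a) => ?; case: (ltP r b) => ?;
    rewrite ?subrr ?normr0//; have := ler_norm (a - b);
    have := ler_norm (b - a); rewrite (distrC b) ler_norml => ? ?;
    apply/andP; split; lra.
have maxL (s a b : R) : `|Num.max s a - Num.max s b| <= `|a - b|.
  by rewrite /Num.max; case: (ltP s a) => ?; case: (ltP s b) => ?;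
    rewrite ?subrr ?normr0//; have := ler_norm (a - b);
    have := ler_norm (b - a); rewrite (distrC b) ler_norml => ? ?;
    apply/andP; split; lra.
apply: mx_norm_le => // i j; have := mx_norm_entry (x - y) 0 j; rewrite !mxE => h.
exact: (le_trans (maxL _ _ _) (le_trans (minL _ _) h)).
Qed.

Lemma clamp_id n r (x : 'rV[R]_n) : `|x| <= r -> clamp r x = x.
Proof.
move=> xr; apply/rowP => j; rewrite mxE.
have := le_trans (mx_norm_entry x 0 j) xr; rewrite ler_norml => /andP[h1 h2].
by rewrite min_r// max_r.
Qed.

(** Lyapunov's indirect method.  Existence comes from the globally Lipschitz
field obtained by clamping the argument; the Lyapunov function traps its
solutions, and all solutions of the original field, in the ball where the two
fields agree. *)
Lemma lyapunov_stability n p (g : 'rV[R]_n -> 'rV[R]_n) (G : 'M[R]_n)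
    (S : 'M[R]_(n, p)) (S' : 'M[R]_(p, n)) (a : R) :
  g 0 = 0 -> strict_diff g 0 G -> 0 < a -> S *m S' = 1%:M ->
  (forall x, dot (x *m S) (x *m G *m S) <= - a * dot (x *m S) (x *m S)) ->
  exists alpha M delta : R, [/\ 0 < alpha, 0 < M, 0 < delta &
    forall x0 : 'rV[R]_n, enorm x0 < delta ->
      exists x : R -> 'rV[R]_n,
        [/\ is_solution g x0 x,
            forall x' : R -> 'rV[R]_n, is_solution g x0 x' ->
              forall t : R, 0 <= t -> x' t = x t
          & forall t : R, 0 <= t ->
              enorm (x t) <= M * expR (- (alpha * t)) * enorm x0]].
Proof.
move=> g0 gG a0 SS' GV; pose V x := dot (x *m S) (x *m S).
pose C : R := p%:R * `|S'| + 1; have C0 : 0 < C by rewrite ltr_wpDl// mulr_ge0.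
have xC x : `|x| <= C * `|x *m S|.
  rewrite -{1}[x]mulmx1 -SS' mulmxA (le_trans (mulmx_norm_le _ _))// mulrAC.
  by rewrite ler_wpM2r// /C lerDl.
have normV x : `|x| ^+ 2 <= C ^+ 2 * V x.
  apply: (@le_trans _ _ ((C * `|x *m S|) ^+ 2)).
    by rewrite lerXn2r ?nnegrE// mulr_ge0// ltW.
  by rewrite exprMn ler_wpM2l ?sqr_ge0// norm_sqr_le_dot.
have [r1 r10 [L L0 gL]] := strict_diff_lipschitz gG.
(* K bounds the effect on V' of the error of linearisation, relative to V;
   an error of slope a / 2 / K therefore leaves half of the decay rate *)
pose K : R := p%:R * (n%:R * `|S|) * C + 1.
have K0 : 0 < K by rewrite ltr_wpDl// !mulr_ge0// ltW.
have [|r2 r20 gr] := gG (a / 2 / K); first by rewrite !divr_gt0.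
pose r := Num.min r1 r2; have r0 : 0 < r by rewrite lt_min r10.
have [rr1 rr2] : r <= r1 /\ r <= r2 by rewrite !ge_min !lexx orbT.
have gV x : `|x| <= r -> dot (x *m S) (g x *m S) <= - (a / 2) * V x.
  move=> xr; have := gr x 0; rewrite !subr0 g0 subr0 normr0 (ltW r20).
  move=> /(_ (le_trans xr rr2) isT) h.
  rewrite -(subrK (x *m G) (g x)) mulmxDl dotDr addrC.
  suff : dot (x *m S) ((g x - x *m G) *m S) <= a / 2 * V x.
    by have := GV x; rewrite -/(V x); lra.
  rewrite (le_trans (ler_norm _))// (le_trans (dot_norm_le _ _))//.
  apply: (@le_trans _ _ (a / 2 * `|x *m S| ^+ 2)); last first.
    by rewrite ler_wpM2l ?divr_ge0 ?(ltW a0)// norm_sqr_le_dot.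
  apply: (@le_trans _ _ (p%:R * `|x *m S| *
      (n%:R * (a / 2 / K * (C * `|x *m S|)) * `|S|))).
    rewrite ler_wpM2l ?mulr_ge0// (le_trans (mulmx_norm_le _ _))//.
    rewrite ler_wpM2r// ler_wpM2l// (le_trans h)// ler_wpM2l//.
    by rewrite !divr_ge0// ltW.
  have -> : p%:R * `|x *m S| * (n%:R * (a / 2 / K * (C * `|x *m S|)) * `|S|) =
      (p%:R * (n%:R * `|S|) * C) / K * (a / 2 * `|x *m S| ^+ 2).
    by field; rewrite gt_eqF.
  rewrite ler_piMl ?mulr_ge0 ?sqr_ge0 ?invr_ge0 ?(ltW a0)//.
  by rewrite ler_pdivrMr// mul1r /K lerDl.
pose c := r ^+ 2 / C ^+ 2.
have Vr x : V x <= c -> `|x| <= r.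
  move=> Vc; rewrite -(@ler_pXn2r _ 2) ?nnegrE ?(ltW r0)//.
  rewrite (le_trans (normV x))// mulrC -ler_pdivlMr ?exprn_gt0//.
pose Q : R := p%:R * (n%:R * `|S|) ^+ 2 + 1.
have Q1 : 1 <= Q by rewrite lerDr mulr_ge0 ?sqr_ge0.
have Q0 : 0 < Q := lt_le_trans ltr01 Q1.
have VQ x : V x <= Q * enorm x ^+ 2.
  rewrite (le_trans (ler_norm _))// (le_trans (dot_norm_le _ _))// -mulrA -expr2.
  apply: (@le_trans _ _ (p%:R * (n%:R * `|S| * enorm x) ^+ 2)).
    rewrite ler_wpM2l// lerXn2r ?nnegrE ?mulr_ge0 ?enorm_ge0//.
    rewrite (le_trans (mulmx_norm_le _ _))// mulrAC.
    by rewrite ler_wpM2l ?mulr_ge0 ?norm_le_enorm.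
  by rewrite exprMn mulrA ler_wpM2r ?sqr_ge0// /Q lerDl.
pose M : R := n%:R * C * Q + 1.
have M0 : 0 < M by rewrite ltr_wpDl// !mulr_ge0// ltW.
exists (a / 2), M, (r / (C * Q)); split => //;
  [by rewrite divr_gt0|by rewrite divr_gt0 ?mulr_gt0|].
move=> x0 x0d.
have Vx0 : V x0 < c.
  apply: (le_lt_trans (VQ x0)).
  apply: (@lt_le_trans _ _ (Q * (r / (C * Q)) ^+ 2)).
    by rewrite ltr_pM2l// ltrXn2r ?nnegrE ?enorm_ge0// divr_ge0 ?mulr_ge0// ltW.
  have -> : Q * (r / (C * Q)) ^+ 2 = c / Q by rewrite /c; field; rewrite !gt_eqF.
  by rewrite ler_pdivrMr// ler_peMr// divr_ge0 ?sqr_ge0.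
have decay (h : 'rV[R]_n -> 'rV[R]_n) x : (forall y, `|y| <= r -> h y = g y) ->
    is_solution h x0 x -> forall t : R, 0 <= t -> V (x t) <= c /\
      V (x t) <= expR (- (2 * (a / 2)) * t) * V x0.
  move=> hg; apply: lyapunov_decay => //; first by rewrite divr_ge0// ltW.
  by move=> y Vy; rewrite hg; [apply: gV|]; exact: Vr.
have [x x00 xP] : exists2 x : R -> 'rV[R]_n, x 0 = x0 &
    forall t : R, 0 <= t -> is_derive t 1 x (g (clamp r (x t))).
  apply: (@picard _ (g \o clamp r) L x0 L0) => u v /=.
  rewrite (le_trans (gL _ _ _ _)) ?subr0 ?(le_trans (clamp_norm _ (ltW r0)))//.
  by rewrite ler_wpM2l ?(ltW L0)// clamp_lipschitz.
have xr t : 0 <= t -> `|x t| <= r.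
  have xsol := @is_derive_is_solution _ (g \o clamp r) x0 x x00 xP.
  move=> t0; apply: Vr; have [] // := decay _ x _ xsol t t0.
  by move=> y yr /=; rewrite clamp_id.
have xsol : is_solution g x0 x.
  apply: is_derive_is_solution => // t t0; have := xP t t0.
  by rewrite clamp_id// xr.
exists x; split => //.
- move=> x' x'sol.
  have gLr u v : `|u| <= r -> `|v| <= r -> `|g u - g v| <= L * `|u - v|.
    by move=> ur vr; apply: gL; rewrite subr0; exact: le_trans rr1.
  apply: (solution_unique (ltW L0) gLr x'sol xsol _ xr).
  by move=> t t0; apply: Vr; have [] := decay _ _ (fun _ _ => erefl) x'sol t t0.
- move=> t t0; have [_ Vt] := decay _ _ (fun _ _ => erefl) xsol t t0.
  rewrite -(@ler_pXn2r _ 2) ?nnegrE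
    ?enorm_ge0 ?mulr_ge0 ?expR_ge0 ?enorm_ge0 ?(ltW M0)//.
  have -> : (M * expR (- (a / 2 * t)) * enorm x0) ^+ 2 =
      M ^+ 2 * (expR (- (2 * (a / 2)) * t) * enorm x0 ^+ 2).
    rewrite !exprMn -mulrA; congr (_ * (_ * _)).
    by rewrite expr2 -expRD; congr expR; field.
  apply: (@le_trans _ _ ((n%:R * `|x t|) ^+ 2)).
    by rewrite lerXn2r ?nnegrE ?enorm_ge0 ?mulr_ge0// enorm_le_norm.
  rewrite exprMn.
  apply: (@le_trans _ _ (n%:R ^+ 2 *
      (C ^+ 2 * (expR (- (2 * (a / 2)) * t) * (Q * enorm x0 ^+ 2))))).
    rewrite ler_wpM2l ?sqr_ge0// (le_trans (normV _))// ler_wpM2l ?sqr_ge0//.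
    by rewrite (le_trans Vt)// ler_wpM2l ?expR_ge0.
  have -> : n%:R ^+ 2 * (C ^+ 2 * (expR (- (2 * (a / 2)) * t) * (Q * enorm x0 ^+ 2))) =
      (n%:R * C) ^+ 2 * Q * (expR (- (2 * (a / 2)) * t) * enorm x0 ^+ 2) by ring.
  rewrite (ler_wpM2r (mulr_ge0 (expR_ge0 _) (sqr_ge0 _)))//.
  apply: (@le_trans _ _ ((n%:R * C * Q) ^+ 2)).
    have -> : (n%:R * C * Q) ^+ 2 = (n%:R * C) ^+ 2 * Q * Q by ring.
    by rewrite ler_peMr// mulr_ge0 ?sqr_ge0// ltW.
  by rewrite lerXn2r ?nnegrE ?(ltW M0) ?mulr_ge0 ?(ltW C0) ?(ltW Q0)// /M lerDl.
Qed.

End Flow.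

(** * Stabilisation and openness *)

Section Stabilizability.
Context {R : realType}.

(** If G annihilated w on the right, dot (x t) w would be conserved along
trajectories up to an error of higher order, whose integral over [0, +oo[ is
small compared with enorm (x 0) by the exponential estimate; but it has to
decrease from its initial value to 0. *)
Lemma exp_stable_injective n (g : 'rV[R]_n -> 'rV[R]_n) (G : 'M[R]_n)
    (alpha M delta : R) (w : 'rV[R]_n) :
  g 0 = 0 -> strict_diff g 0 G -> 0 < alpha -> 0 < M -> 0 < delta ->
  (forall x0, enorm x0 < delta -> exists2 x, is_solution g x0 x &
     forall t : R, 0 <= t -> enorm (x t) <= M * expR (- (alpha * t)) * enorm x0) ->
  w *m G^T = 0 -> w = 0.
Proof.
move=> g0 gG a0 M0 d0 stable wG; apply/eqP; apply: contraT => w0.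
have N0 : 0 < enorm w by rewrite lt_def enorm_eq0 w0 enorm_ge0.
(* e and, below, T are such that the integrated error and the final value each
   account for at most a quarter of the initial value of dot (x t) w *)
pose e := alpha / (4 * (n.+1%:R * M)).
have e0 : 0 < e by rewrite divr_gt0 ?mulr_gt0.
have [r r0 gr] := gG e e0.
pose sigma := Num.min (delta / 2) (r / M).
have sigma0 : 0 < sigma by rewrite lt_min !divr_gt0.
have sigmad : sigma < delta.
  rewrite (@le_lt_trans _ _ (delta / 2)) ?ge_min ?lexx// ltr_pdivrMr//.
  by rewrite ltr_pMr// ltr1n.
have sigmar : M * sigma <= r by rewrite mulrC -ler_pdivlMr// ge_min lexx orbT.
pose x0 := (sigma / enorm w) *: w.
have x0E : enorm x0 = sigma.
  rewrite enormZ ger0_norm ?divr_ge0 ?ltW// divfK// gt_eqF//.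
have [|x xsol xb] := stable x0; first by rewrite x0E.
have [x00 _ xP] := xsol.
have xr (t : R) : 0 <= t -> `|x t| <= r.
  move=> t0; rewrite (le_trans (norm_le_enorm _))// (le_trans (xb t t0))//.
  rewrite x0E mulrAC (le_trans _ sigmar)// ler_piMr ?mulr_ge0 ?(ltW M0) ?(ltW sigma0)//.
  by rewrite -[leRHS]expR0 ler_expR oppr_le0 mulr_ge0 ?(ltW a0).
pose K := n%:R * (e * M * sigma) * enorm w / alpha.
pose psi (t : R) : R := dot (x t) w.
pose f (t : R) : R := K * expR (- alpha * t) - psi t.
have psiP (t : R) : 0 < t -> is_derive t 1 psi (dot (g (x t)) w).
  move=> /xP xt; have := is_derive_dot xt (is_derive_cst w t 1).
  by rewrite [dot _ 0]dotE trmx0 mulmx0 mxE addr0.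
have eP (t : R) : is_derive t 1 (fun t => K * expR (- alpha * t))
    (K * (- alpha * expR (- alpha * t))).
  have := is_derive1M (is_derive1_cst K t) (is_derive_expRM (- alpha) t).
  by rewrite mul0r add0r.
pose T := 4 * M / alpha.
have T0 : 0 <= T by rewrite divr_ge0 ?mulr_ge0 ?ltW.
have fT : f T <= f 0.
  apply: (@nonincreasing_itv _ f
    (fun t => K * (- alpha * expR (- alpha * t)) - dot (g (x t)) w) 0 T T0).
  - by move=> t t0; apply: is_derive1B (eP t) (psiP t t0).
  - apply: cvgB; first exact: is_derive_cvg_right (eP 0).
    by apply: cvg_dot; [exact: is_solution_cvg0 xsol|exact: cvg_cst].
  - move=> t /andP[/ltW t0 _].
    have -> : dot (g (x t)) w = dot (g (x t) - x t *m G) w.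
      have xGw : dot (x t *m G) w = 0 by rewrite dot_mulmx wG dotE trmx0 mulmx0 mxE.
      by rewrite -{1}(subrK (x t *m G) (g (x t))) [LHS]dotDl xGw addr0.
    have h : `|g (x t) - x t *m G| <= e * (M * expR (- (alpha * t)) * sigma).
      have := gr (x t) 0; rewrite !subr0 g0 subr0 normr0 => /(_ (xr t t0) (ltW r0)) h.
      rewrite (le_trans h)// ler_wpM2l ?(ltW e0)// -x0E.
      exact: le_trans (norm_le_enorm _) (xb t t0).
    set D := dot _ w.
    have : `|D| <= K * (alpha * expR (- alpha * t)).
      rewrite (le_trans (dot_norm_le _ _))//.
      apply: (@le_trans _ _
        (n%:R * (e * (M * expR (- (alpha * t)) * sigma)) * enorm w)).
        by rewrite ler_pM ?mulr_ge0 ?norm_le_enorm// ler_wpM2l.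
      rewrite /K mulNr le_eqVlt; apply/orP; left; apply/eqP; field.
      by rewrite gt_eqF.
    by rewrite ler_norml => /andP[]; lra.
have K0 : 0 <= K.
  apply: divr_ge0 (ltW a0); apply: mulr_ge0 (ltW N0); apply: mulr_ge0 => //.
  exact: mulr_ge0 (mulr_ge0 (ltW e0) (ltW M0)) (ltW sigma0).
have psi0 : psi 0 = sigma * enorm w.
  by rewrite /psi x00 dotZl -enorm_sqr; field; rewrite gt_eqF.
have psiT : psi T <= M * expR (- (alpha * T)) * (sigma * enorm w).
  rewrite (le_trans (ler_norm _))// (le_trans (cauchy_schwarz _ _))// mulrA.
  by rewrite -x0E ler_wpM2r ?enorm_ge0// xb.
have MT : M * expR (- (alpha * T)) <= 4^-1.
  have -> : alpha * T = 4 * M by rewrite /T; field; rewrite gt_eqF.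
  rewrite expRN ler_pdivrMr ?expR_gt0//.
  by have := expR_ge1Dx (4 * M); lra.
have sN : 0 < sigma * enorm w by rewrite mulr_gt0.
have K4 : K <= 4^-1 * (sigma * enorm w).
  have -> : K = n%:R / n.+1%:R * (4^-1 * (sigma * enorm w)).
    by rewrite /K /e; field; rewrite !gt_eqF// ltr0n.
  apply: ler_piMl; last by rewrite ler_pdivrMr// mul1r ler_nat.
  by apply: mulr_ge0 (ltW sN); rewrite invr_ge0.
have := ler_wpM2r (ltW sN) MT.
have := mulr_ge0 K0 (expR_ge0 (- alpha * T)).
by move: fT; rewrite /f mulr0 expR0 mulr1 psi0; lra.
Qed.

Lemma mulmxr_continuous m n (K : 'M[R]_(m, n)) :
  continuous (fun x : 'rV[R]_m => x *m K).
Proof.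
by move=> v; exact: (@cvg_mulmx _ _ _ _ (nbhs v) _ id K v (@cvg_id _ (nbhs v))).
Qed.

Lemma strict_diff_closed_loop n m (f : 'rV[R]_(n + m) -> 'rV[R]_n)
    (u : 'rV[R]_n -> 'rV[R]_m) J K :
  u 0 = 0 -> strict_diff f (row_mx 0 0) J -> strict_diff u 0 K ->
  strict_diff (fun x => f (row_mx x (u x))) 0 (row_mx 1%:M K *m J).
Proof.
move=> u0 fJ uK; apply: (@strict_diff_comp _ _ _ _ (fun x => row_mx x (u x)) f).
  exact: strict_diff_graph.
by rewrite u0.
Qed.

(** The bound on the modulus enters through the Hautus test: at an eigenvalue
lambda of A in [0, kappa[, a left eigenvector w with w *m B = 0 would violate
[lin_open_modulus_le]. *)
Lemma stabilizable_of_modulus n m (f : 'rV[R]_(n + m) -> 'rV[R]_n) (kappa : R) J :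
  f (row_mx 0 0) = 0 -> strict_diff f (row_mx 0 0) J ->
  lin_open_modulus f (row_mx 0 0) kappa ->
  Lambda_plus (lsubmx J^T) `<=` [set z | complex.Im z = 0 /\ complex.Re z < kappa] ->
  loc_exp_stabilizable_C0 f.
Proof.
move=> f00 fJ fk Lk; pose A := lsubmx J^T; pose B := rsubmx J^T.
have JT : J^T = row_mx A B by rewrite hsubmxK.
have rootL z : root (map_poly (real_complex R) (char_poly A)) z ->
    0 <= complex.Re z -> Lambda_plus A z.
  by rewrite map_char_poly -eigenvalue_root_char.
have [F Fst] : exists F : 'M[R]_(m, n), stable_poly (char_poly (A + B *m F)).
  apply: stabilizing_feedback => [z zA z0|l w l0 w0 wA].
    by have [] := Lk z (rootL z zA z0).
  apply/eqP => wB.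
  have [|_ /= lk] := Lk (real_complex R l).
    apply: rootL => //; rewrite fmorph_root -eigenvalue_root_char.
    by apply/eigenvalueP; exists w.
  have := lin_open_modulus_le fJ fk w.
  rewrite JT mul_mx_row wA wB enorm_row_mx0 enormZ (ger0_norm l0).
  by rewrite ler_pM2r ?leNgt ?lk// lt_def enorm_eq0 w0 enorm_ge0.
pose K := F^T; pose u (x : 'rV[R]_n) := x *m K.
have u0 : u 0 = 0 by rewrite /u mul0mx.
pose G := row_mx 1%:M K *m J.
have gG : strict_diff (fun x => f (row_mx x (u x))) 0 G.
  by apply: strict_diff_closed_loop => //; exact: strict_diff_linear.
have Gst : stable_poly (char_poly G).
  rewrite -char_poly_trmx trmx_mul JT tr_row_mx trmx1 trmxK mul_row_col mulmx1.
  exact: Fst.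
have [p [S [S' [a [a0 SS' GV]]]]] := stable_lyapunov Gst.
exists u; first exact: mulmxr_continuous.
split => //; apply: lyapunov_stability gG a0 SS' GV.
by rewrite u0.
Qed.

(** The derivative G of the closed loop factors through J, so that inverting G
inverts J on one side. *)
Lemma lin_open_of_stabilizable n m (f : 'rV[R]_(n + m) -> 'rV[R]_n) J :
  f (row_mx 0 0) = 0 -> strict_diff f (row_mx 0 0) J ->
  loc_exp_stabilizable_C1 f -> lin_open f (row_mx 0 0).
Proof.
move=> f00 fJ [u uC1 [u0 [alpha [M [delta [a0 M0 d0 stable]]]]]].
have uK : strict_diff u 0 (jacobian u 0).
  apply: C1_near_strict_diff.
  by apply: (@filterE _ (nbhs (0 : 'rV[R]_n))) => z; exact: uC1.
have gG := strict_diff_closed_loop u0 fJ uK; set G := _ *m J in gG.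
have Gu : G \in unitmx.
  rewrite -unitmx_tr -row_free_unit; apply: inj_row_free => w wG.
  apply: (exp_stable_injective _ gG a0 M0 d0 _ wG); first by rewrite u0.
  by move=> x0 /stable[x [xsol _ xb]]; exists x.
apply: (strict_diff_lin_open fJ (E := invmx G *m row_mx 1%:M (jacobian u 0))).
by rewrite -mulmxA mulVmx.
Qed.

End Stabilizability.

Unset Implicit Arguments.

Theorem theorem3p2 (R : realType) (n m : nat)
    (f : 'rV[R]_(n + m) -> 'rV[R]_n)
    (f00 : f (row_mx 0 0) = 0) (fC1 : C1_near f (row_mx 0 0)) :
  (forall A : 'M[R]_n, A = nabla_x f (row_mx 0 0) ->
    Lambda_plus A `<=` [set lambda | complex.Im lambda = 0] ->
    lin_open f (row_mx 0 0) ->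
    forall kappa : R, 0 < kappa ->
      (kappa%:E < cov f (row_mx 0 0))%E ->
      (eta_c A < kappa%:E)%E ->
      loc_exp_stabilizable_C0 f) /\
  (loc_exp_stabilizable_C1 f -> lin_open f (row_mx 0 0)).
Proof.
have fJ := C1_near_strict_diff fC1.
split; last exact: lin_open_of_stabilizable f00 fJ.
move=> A -> Areal _ kappa _ /ereal_sup_gt[_ [k fk <-] kappak] etak.
apply: (stabilizable_of_modulus f00 fJ fk) => z zL; split; first exact: Areal.
rewrite -lte_fin (le_lt_trans _ (lt_trans etak kappak))//.
by apply: ereal_sup_ubound; exists z.
Qed.
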